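(* Let $\Theta, B$ be finite Blaschke products with $\deg B < \deg \Theta$. Then the inequality $$\max\{|B(z)| : z\in W(S_\Theta)\} \ge \tfrac12$$ holds in each of the following cases: (i) $\deg\Theta = n$ and there is a pseudohyperbolic disk $D_\rho(z_0, (\tfrac12)^{1/(n-1)}) \subseteq W(S_\Theta)$ for some $z_0\in\mathbb{D}$; (ii) $\deg B = 2$ and $\deg\Theta\ge 6$; (iii) $B(0)=0$, $|B'(0)|\ge \tfrac{2\sqrt2}{3}$, $\deg\Theta\ge 9$, and $0\in W(S_\Theta)$; (iv) $\deg B=2$ and the set $\Omega^B_{1/2} = \{z\in\mathbb{C}: |B(z)|<\tfrac12\}$ has two connected components.
   Context: $\mathbb{D}$ is the open unit disk and $\mathbb{T}$ the unit circle. A finite Blaschke product of degree $n$ is a function $\lambda \prod_{j=1}^n \frac{z-a_j}{1-\bar{a}_j z}$ with $a_1,\dots,a_n\in\mathbb{D}$ (not necessarily distinct) and $\lambda\in\mathbb{T}$. For a finite Blaschke product $\Theta$, $K_\Theta = H^2\ominus \Theta H^2$, where $H^2=H^2(\mathbb{D})$ is the Hardy space; $\dim K_\Theta = \deg\Theta$. The compression of the shift is $S_\Theta = P_\Theta M_z|_{K_\Theta}$, where $P_\Theta$ is the orthogonal projection of $H^2$ onto $K_\Theta$ and $M_z$ is multiplication by $z$. The numerical range of an operator $A$ is $W(A)=\{\langle Ax,x\rangle : \|x\|=1\}$. The pseudohyperbolic disk with center $z_0\in\mathbb{D}$ and radius $r\in(0,1)$ is $D_\rho(z_0,r) = \{z\in\mathbb{D}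 : |\frac{z-z_0}{1-\bar z_0 z}|<r\}$. *)

(* Defs.v *)
From HB Require Import structures.
From mathcomp Require Import all_boot all_order all_algebra.
From mathcomp Require Import complex.
From mathcomp Require Import all_classical all_reals all_analysis.

Set Implicit Arguments.
Unset Strict Implicit.
Unset Printing Implicit Defensive.

Import Order.TTheory GRing.Theory Num.Theory.
Import numFieldNormedType.Exports.

Local Open Scope classical_set_scope.
Local Open Scope ring_scope.

(* The regular-algebra alias R[i]^o is what carries the library's topology and
   normed-module structure on the complex numbers.  The norm `|z| of a complex
   number is itself an element of R[i] (with zero imaginary part), and for
   elements of R[i] the relation x <= y means that y - x is a nonnegative
   real. *)
Notation cplx R := (R[i]^o).

Definition unit_disk (R : realType) : set (cplx R) := [set z | `|z| < 1].

Record finBlaschke (R : realType) := FinBlaschke {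
  bl_const : cplx R;
  bl_zeros : seq (cplx R);   (* listed with multiplicity *)
  bl_constP : `|bl_const| = 1;
  bl_zerosP : forall a, a \in bl_zeros -> unit_disk a
}.

Definition bl_deg (R : realType) (B : finBlaschke R) : nat :=
  size (bl_zeros B).

(* Since x / 0 = 0, this total function takes the junk value 0 at the poles
   1 / a^*, a a nonzero zero of B; these all lie outside the closed disk. *)
Definition bl_fun (R : realType) (B : finBlaschke R) (z : cplx R) : cplx R :=
  bl_const B * \prod_(a <- bl_zeros B) ((z - a) / (1 - a^* * z)).

Coercion bl_fun : finBlaschke >-> Funclass.

(* The poles are excluded explicitly: because of their junk value they would
   otherwise be spurious isolated points of the set. *)
Definition bl_sublevel (R : realType) (B : finBlaschke R) (c : cplx R) :
    set (cplx R) :=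
  [set z | (forall a, a \in bl_zeros B -> 1 - a^* * z != 0) /\ `|B z| < c].

Definition components (T : topologicalType) (A : set T) : set (set T) :=
  [set connected_component A x | x in A].

Definition pseudohyp_disk (R : realType) (z0 : cplx R) (r : R) :
    set (cplx R) :=
  [set z | unit_disk z /\ `|(z - z0) / (1 - z0^* * z)| < r%:C%C].

(* Functions on the unit disk are represented by total functions whose values
   off the disk are irrelevant. *)
Definition taylor_expansion (R : realType) (f : cplx R -> cplx R)
    (a : nat -> cplx R) : Prop :=
  forall z, unit_disk z ->
    series (fun k => a k * z ^+ k) n @[n --> \oo] --> f z.

Definition hardy2 (R : realType) : set (cplx R -> cplx R) :=
  [set f | exists2 a : nat -> cplx R, taylor_expansion f a &
           cvgn (series (fun k => `|a k| ^+ 2 : cplx R))].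

Definition taylor_coef (R : realType) (f : cplx R -> cplx R) : nat -> cplx R :=
  xget (fun=> 0) [set a | taylor_expansion f a].

Definition hdot (R : realType) (f g : cplx R -> cplx R) : cplx R :=
  limn (series (fun k => taylor_coef f k * (taylor_coef g k)^*)).

Definition hnorm (R : realType) (f : cplx R -> cplx R) : cplx R :=
  sqrtC (hdot f f).

(* Orthogonal projection of f onto the subspace K of H^2; as an element of H^2
   it is unique. *)
Definition hproj (R : realType) (K : set (cplx R -> cplx R))
    (f : cplx R -> cplx R) : cplx R -> cplx R :=
  xget (fun=> 0) [set g | K g /\ forall h, K h -> hdot (f \- g) h = 0].

Definition model_space (R : realType) (Theta : finBlaschke R) :
    set (cplx R -> cplx R) :=
  [set f | hardy2 f /\
           forall h, @hardy2 R h -> hdot f (fun z => Theta z * h z) = 0].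

Definition compressed_shift (R : realType) (Theta : finBlaschke R)
    (f : cplx R -> cplx R) : cplx R -> cplx R :=
  hproj (model_space Theta) (fun z => z * f z).

Definition numerical_range (R : realType) (K : set (cplx R -> cplx R))
    (A : (cplx R -> cplx R) -> (cplx R -> cplx R)) : set (cplx R) :=
  [set hdot (A f) f | f in [set f | K f /\ hnorm f = 1]].

Definition W_shift (R : realType) (Theta : finBlaschke R) : set (cplx R) :=
  numerical_range (model_space Theta) (compressed_shift Theta).

Definition is_max (R : realType) (S : set (cplx R)) (m : cplx R) : Prop :=
  S m /\ ubound S m.

(* Main.v *)
(* For f in K_Theta of norm one, <S_Theta f, f> = <z f, f>.  Let P/Q be Theta up to
   a unimodular constant, with P monic.  The n + 1 roots of Q - z P are unimodular
   and distinct, and for two of them, p and q, the function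
   f = (Q - z P) / (Q (z - p) (z - q)) lies in K_Theta, with (z - p) f orthogonal to
   (z - q) f; hence <z f, f> / <f, f> is on the chord [p, q].  So W(S_Theta) meets
   every chord of an inscribed (n + 1)-gon.
   Given c in the disk, move the hyperbolic midpoint m of 0 and c to 0 by a disk
   automorphism: if the images of p and q are at angular distance at most
   2 arccos r, then the chord [p, q] avoids the pseudohyperbolic disk of center c
   and radius r.  By the pigeonhole principle W(S_Theta) is contained in no such
   disk with r^2 = 1/2 if n >= 3, nor with r^2 = 4/5 if n >= 6.
   For deg B = 2 let c be the hyperbolic midpoint of the zeros, so that B is, up to
   automorphisms, u |-> (u - b^2) / (1 - conj b^2 u) with u the square of the
   coordinate centered at c.  If |b|^2 >= 1/2, then |B| >= 1/2 on the bisector of the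
   zeros, and W(S_Theta), being connected and in neither of the disks of radius
   sqrt(1/2) about the zeros, meets it unless |B| >= 1/2 somewhere on it already.  If
   |b|^2 < 1/2, the sublevel set is connected (star-shaped about c), and |B| >= 1/2
   outside the disk of squared radius 4/5 about c.  In case (iii) a Schwarz-Pick
   estimate gives |B| >= 1/2 on |z| = sqrt(1/2), a circle that W(S_Theta) meets.
   Case (i) is Jensen's inequality on the disk. *)
Require Import Defs.
From HB Require Import structures.
From mathcomp Require Import all_boot all_order all_algebra.
From mathcomp Require Import complex ring lra.
From mathcomp Require Import all_classical all_reals all_analysis.

Set Implicit Arguments.
Unset Strict Implicit.
Unset Printing Implicit Defensive.

Import Order.TTheory GRing.Theory Num.Theory.
Import numFieldNormedType.Exports.

Local Open Scope classical_set_scope.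
Local Open Scope ring_scope.

Local Notation Re := complex.Re.
Local Notation Im := complex.Im.

(** * Squared moduli and convergence in the complex plane *)

(** The norm of [R[i]] takes values in [R[i]]; a squared modulus in [R] keeps the estimates
    polynomial over an ordered field, where [lra] and [nra] apply. *)
Definition nsq {R : realType} (z : cplx R) : R := Re z ^+ 2 + Im z ^+ 2.

Section ComplexBasics.
Variable R : realType.
Implicit Types (x y z : cplx R).

Lemma conjE (a b : R) : (Complex a b : cplx R)^* = Complex a (- b).
Proof. by []. Qed.

Lemma nsq_norm z : `|z| ^+ 2 = (nsq z)%:C%C :> cplx R.
Proof. by rewrite /nsq add_Re2_Im2. Qed.

Lemma nsq_conj z : z * z^* = (nsq z)%:C%C.
Proof. by rewrite -nsq_norm sqr_normc. Qed.

Lemma nsq_ge0 z : 0 <= nsq z.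
Proof. by rewrite addr_ge0 ?sqr_ge0. Qed.

Lemma nsqM x y : nsq (x * y) = nsq x * nsq y.
Proof. by case: x => a b; case: y => c d; rewrite /nsq /=; ring. Qed.

Lemma nsqJ z : nsq (z^*) = nsq z.
Proof. by case: z => a b; rewrite conjE /nsq /= sqrrN. Qed.

Lemma nsqN z : nsq (- z) = nsq z.
Proof. by case: z => a b; rewrite /nsq /= !sqrrN. Qed.

Lemma nsq0 : nsq (0 : cplx R) = 0.
Proof. by rewrite /nsq /= expr0n addr0. Qed.

Lemma nsq1 : nsq (1 : cplx R) = 1.
Proof. by rewrite /nsq /= expr0n addr0 expr1n. Qed.

Lemma nsq_real (a : R) : nsq (a%:C%C : cplx R) = a ^+ 2.
Proof. by rewrite /nsq /= expr0n addr0. Qed.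

Lemma nsq_eq0 z : (nsq z == 0) = (z == 0).
Proof.
case: z => a b; rewrite /nsq /= paddr_eq0 ?sqr_ge0 // !sqrf_eq0.
by rewrite eq_complex.
Qed.

Lemma nsq_gt0 z : (0 < nsq z) = (z != 0).
Proof. by rewrite lt_def nsq_ge0 andbT nsq_eq0. Qed.

Lemma nsqV z : nsq z^-1 = (nsq z)^-1.
Proof.
have [->|z0] := eqVneq z 0; first by rewrite invr0 nsq0 invr0.
have nz : nsq z != 0 by rewrite nsq_eq0.
by apply: (mulIf nz); rewrite -nsqM !mulVf // nsq1.
Qed.

Lemma nsqX z n : nsq (z ^+ n) = nsq z ^+ n.
Proof. by elim: n => [|n IH]; rewrite ?nsq1 // !exprS nsqM IH. Qed.

Lemma nsq_prod (I : Type) (s : seq I) (F : I -> cplx R) :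
  nsq (\prod_(i <- s) F i) = \prod_(i <- s) nsq (F i).
Proof.
by elim: s => [|i s IH]; rewrite ?big_nil ?nsq1 // !big_cons nsqM IH.
Qed.

Lemma norm_nsq z : `|z| = (Num.sqrt (nsq z))%:C%C :> cplx R.
Proof. by rewrite normc_def. Qed.

Lemma ler_nsq x y : (`|x| <= `|y| :> cplx R) = (nsq x <= nsq y).
Proof. by rewrite !norm_nsq lecR ler_sqrt // nsq_ge0. Qed.

Lemma ltr_nsqr x (r : R) : 0 <= r ->
  (`|x| < r%:C%C :> cplx R) = (nsq x < r ^+ 2).
Proof.
move=> r0; rewrite norm_nsq ltcR -{1}(ger0_norm r0) -sqrtr_sqr.
have [->|r0'] := eqVneq r 0.
  by rewrite expr0n /= sqrtr0 !ltNge sqrtr_ge0 nsq_ge0.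
by rewrite ltr_sqrt // exprn_gt0 // lt_def r0' r0.
Qed.

Lemma ger_nsqr x (r : R) : 0 <= r ->
  (r%:C%C <= `|x| :> cplx R) = (r ^+ 2 <= nsq x).
Proof.
by move=> r0; rewrite norm_nsq lecR -{1}(ger0_norm r0) -sqrtr_sqr ler_sqrt ?nsq_ge0.
Qed.

Lemma unit_diskE z : unit_disk z = (nsq z < 1) :> Prop.
Proof. by rewrite /unit_disk /= (@ltr_nsqr z 1) // expr1n. Qed.

Lemma norm1_nsq z : `|z| = 1 -> nsq z = 1.
Proof. by move=> h; apply: complexI; rewrite -nsq_norm h expr1n. Qed.

Lemma sqsum_lt (e x y : R) : `|y| < e / 2 -> `|x| < e / 2 ->
  x ^+ 2 + y ^+ 2 < e ^+ 2.
Proof.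
rewrite !ltr_norml => /andP[y1 y2] /andP[x1 x2].
have := mulr_gt0 (_ : 0 < e / 2 - x) (_ : 0 < e / 2 + x).
have := mulr_gt0 (_ : 0 < e / 2 - y) (_ : 0 < e / 2 + y).
move=> /(_ ltac:(lra) ltac:(lra)) h1 /(_ ltac:(lra) ltac:(lra)) h2.
have : 0 < e by lra.
nra.
Qed.

Lemma cvg_complex (T : Type) (F : set_system T) {FF : Filter F}
    (u : T -> cplx R) (l : cplx R) :
  Re (u x) @[x --> F] --> Re l -> Im (u x) @[x --> F] --> Im l -> u @ F --> l.
Proof.
move=> /cvgrPdist_lt h1 /cvgrPdist_lt h2; apply/cvgrPdist_lt => e e0.
have e0' : 0 < Re e by move: e0; rewrite ltcE => /andP[].
have -> : e = (Re e)%:C%C by case: e e0 e0' => a b; rewrite ltcE => /andP[/= /eqP -> _].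
near=> x; rewrite ltr_nsqr ?ltW //.
have : `|Re l - Re (u x)| < Re e / 2 by near: x; apply: h1; rewrite divr_gt0.
have : `|Im l - Im (u x)| < Re e / 2 by near: x; apply: h2; rewrite divr_gt0.
rewrite /nsq; case: (l) (u x) => a b [c d] /=; exact: sqsum_lt.
Unshelve. all: by end_near. Qed.

Lemma cvg_Re (T : Type) (F : set_system T) {FF : Filter F}
    (u : T -> cplx R) (l : cplx R) :
  u @ F --> l -> Re (u x) @[x --> F] --> Re l.
Proof.
move=> /cvgrPdist_lt h; apply/cvgrPdist_lt => e e0.
have h' := h e%:C%C; rewrite ltcR in h'; move: (h' e0).
apply: filterS => x; rewrite ltr_nsqr ?ltW // /nsq.
case: (l) (u x) => a b [c d] /= h1.
rewrite -ltr_sqr ?nnegrE ?normr_ge0 ?ltW // real_normK ?num_real //.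
by apply: le_lt_trans h1; rewrite lerDl sqr_ge0.
Qed.

Lemma cvg_Im (T : Type) (F : set_system T) {FF : Filter F}
    (u : T -> cplx R) (l : cplx R) :
  u @ F --> l -> Im (u x) @[x --> F] --> Im l.
Proof.
move=> /cvgrPdist_lt h; apply/cvgrPdist_lt => e e0.
have h' := h e%:C%C; rewrite ltcR in h'; move: (h' e0).
apply: filterS => x; rewrite ltr_nsqr ?ltW // /nsq.
case: (l) (u x) => a b [c d] /= h1.
rewrite -ltr_sqr ?nnegrE ?normr_ge0 ?ltW // real_normK ?num_real //.
by apply: le_lt_trans h1; rewrite lerDr sqr_ge0.
Qed.

Lemma cvg_conj (T : Type) (F : set_system T) {FF : Filter F}
    (u : T -> cplx R) (l : cplx R) :
  u @ F --> l -> (u x)^* @[x --> F] --> (l^* : cplx R).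
Proof.
move=> h; apply: cvg_complex.
  have -> : (fun t => Re (u t)^*) = (fun t => Re (u t)).
    by apply/funext => t; case: (u t).
  have -> : Re l^* = Re l by case: l {h}.
  exact: cvg_Re.
have -> : (fun t => Im (u t)^*) = (fun t => - Im (u t)).
  by apply/funext => t; case: (u t).
have -> : Im l^* = - Im l by case: l {h}.
by apply: cvgN; exact: cvg_Im.
Qed.

Lemma cvg_nsq (T : Type) (F : set_system T) {FF : Filter F}
    (u : T -> cplx R) (l : cplx R) :
  u @ F --> l -> nsq (u x) @[x --> F] --> nsq l.
Proof.
move=> h; rewrite (_ : (fun _ => _) = (fun t => Re (u t) * Re (u t) + Im (u t) * Im (u t))).
  by rewrite /nsq !expr2; apply: cvgD; apply: cvgM; by [exact: cvg_Re|exact: cvg_Im].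
by apply/funext => t; rewrite /nsq !expr2.
Qed.

End ComplexBasics.

(** * Square-summable sequences *)

Section SquareSummable.
Variable R : realType.
Implicit Types (a b f g : nat -> cplx R).

(** Bounded partial sums, rather than a convergent series, so that closure under the operations
    below is a comparison of finite sums. *)
Definition l2 a := exists M : R, forall n, \sum_(0 <= k < n) nsq (a k) <= M.

Definition ip a b : cplx R := limn (series (fun k => a k * (b k)^* : cplx R)).

Definition sqn a : R := Re (ip a a).

(** [sh] is multiplication by z on Taylor coefficients; [bk], the backward shift, is its adjoint. *)
Definition sh a : nat -> cplx R := fun k => if k is j.+1 then a j else 0.

Definition bk a : nat -> cplx R := fun k => a k.+1.

Lemma Re_series (u : nat -> cplx R) n :
  Re (series u n) = series (fun k => Re (u k)) n.
Proof.
rewrite /series /=; elim: n => [|n IH]; first by rewrite !big_geq.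
by rewrite !big_nat_recr //= -IH; case: (\sum_(_ <= _ < _) _) (u n) => x y [].
Qed.

Lemma Im_series (u : nat -> cplx R) n :
  Im (series u n) = series (fun k => Im (u k)) n.
Proof.
rewrite /series /=; elim: n => [|n IH]; first by rewrite !big_geq.
by rewrite !big_nat_recr //= -IH; case: (\sum_(_ <= _ < _) _) (u n) => x y [].
Qed.

Lemma cvg_series_dominated (u v : nat -> R) :
  (forall k, `|u k| <= v k) ->
  (exists M : R, forall n, series v n <= M) -> cvgn (series u).
Proof.
move=> uv [M vM]; apply: normed_cvg; rewrite /normed_series_of /=.
apply: nondecreasing_is_cvgn; first exact: nondecreasing_series.
exists M => _ [n _ <-]; apply: le_trans (vM n).
by apply: ler_sum => k _; exact: uv.
Qed.

Lemma sum_nsqZ (c : cplx R) a n :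
  \sum_(0 <= k < n) nsq (c * a k) = nsq c * \sum_(0 <= k < n) nsq (a k).
Proof. by rewrite big_distrr /=; apply: eq_bigr => k _; rewrite nsqM. Qed.

Lemma nsqD_le (x y : cplx R) : nsq (x + y) <= 2 * nsq x + 2 * nsq y.
Proof.
case: x y => p q [r s]; rewrite /nsq /=.
have := sqr_ge0 (p - r); have := sqr_ge0 (q - s); nra.
Qed.

Lemma l2_0 : l2 (fun=> 0).
Proof. by exists 0 => n; rewrite big1 // => k _; rewrite nsq0. Qed.

Lemma l2D a b : l2 a -> l2 b -> l2 (fun k => a k + b k).
Proof.
move=> [M aM] [N bN]; exists (2 * M + 2 * N) => n.
apply: (@le_trans _ _ (\sum_(0 <= k < n) (2 * nsq (a k) + 2 * nsq (b k)))).
  by apply: ler_sum => k _; exact: nsqD_le.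
by rewrite big_split /= -!big_distrr /= lerD // ler_wpM2l.
Qed.

Lemma l2Z (c : cplx R) a : l2 a -> l2 (fun k => c * a k).
Proof.
move=> [M aM]; exists (nsq c * M) => n.
by rewrite sum_nsqZ ler_wpM2l // nsq_ge0.
Qed.

Lemma l2B a b : l2 a -> l2 b -> l2 (fun k => a k - b k).
Proof.
move=> la /(l2Z (-1)) lb; have := l2D la lb.
by rewrite (_ : (fun k => _) = (fun k => a k - b k)) //; apply/funext => k; rewrite mulN1r.
Qed.

Lemma l2_sh a : l2 a -> l2 (sh a).
Proof.
move=> [M aM]; exists M => -[|n].
  by rewrite big_geq //; apply: le_trans (aM 0%N); rewrite big_geq.
by rewrite big_nat_recl //= nsq0 add0r.
Qed.

Lemma l2_bk a : l2 a -> l2 (bk a).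
Proof.
move=> [M aM]; exists M => n; apply: le_trans (aM n.+1).
by rewrite big_nat_recl // lerDr nsq_ge0.
Qed.

(** The real and imaginary parts of each term are dominated by |a k|^2 + |b k|^2, so both series
    converge absolutely. *)
Lemma ip_cvg a b : l2 a -> l2 b ->
  series (fun k => a k * (b k)^* : cplx R) @ \oo --> ip a b.
Proof.
move=> [M aM] [N bN].
have dom : exists K : R, forall n,
    series (fun k => nsq (a k) + nsq (b k)) n <= K.
  by exists (M + N) => n; rewrite /series /= big_split /= lerD.
set u := fun k => _.
have c1 : cvgn (series (fun k => Re (u k))).
  apply: cvg_series_dominated dom => k; rewrite /u.
  case: (a k) (b k) => p q [r s]; rewrite conjE /nsq /= ler_norml.
  have := sqr_ge0 (p + r); have := sqr_ge0 (p - r).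
  have := sqr_ge0 (q + s); have := sqr_ge0 (q - s) => *.
  by apply/andP; split; nra.
have c2 : cvgn (series (fun k => Im (u k))).
  apply: cvg_series_dominated dom => k; rewrite /u.
  case: (a k) (b k) => p q [r s]; rewrite conjE /nsq /= ler_norml.
  have := sqr_ge0 (p + s); have := sqr_ge0 (p - s).
  have := sqr_ge0 (q + r); have := sqr_ge0 (q - r) => *.
  by apply/andP; split; nra.
suff : series u @ \oo --> (Complex (limn (series (fun k => Re (u k))))
                           (limn (series (fun k => Im (u k)))) : cplx R).
  by move=> h; apply/cvg_ex; eexists; exact: h.
apply: cvg_complex => /=.
  by under eq_fun do rewrite Re_series; exact: c1.
by under eq_fun do rewrite Im_series; exact: c2.
Qed.

Lemma ip_unique a b l : l2 a -> l2 b ->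
  series (fun k => a k * (b k)^* : cplx R) @ \oo --> l -> ip a b = l.
Proof. by move=> la lb h; apply: cvg_lim h; exact: norm_hausdorff. Qed.

Lemma ipDl a b f : l2 a -> l2 b -> l2 f ->
  ip (fun k => a k + b k) f = ip a f + ip b f.
Proof.
move=> la lb lf; apply: ip_unique => //; first exact: l2D.
rewrite (_ : series _ = series (fun k => a k * (f k)^* : cplx R) \+
                        series (fun k => b k * (f k)^* : cplx R)).
  by apply: cvgD; exact: ip_cvg.
apply/funext => n; rewrite /series /= -big_split /=.
by apply: eq_bigr => k _; rewrite mulrDl.
Qed.

Lemma ipZl (c : cplx R) a f : l2 a -> l2 f -> ip (fun k => c * a k) f = c * ip a f.
Proof.
move=> la lf; apply: ip_unique => //; first exact: l2Z.
rewrite (_ : series _ = fun n => c * series (fun k => a k * (f k)^* : cplx R) n).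
  by apply: cvgMr; exact: ip_cvg.
apply/funext => n; rewrite /series /= big_distrr /=.
by apply: eq_bigr => k _; rewrite mulrA.
Qed.

Lemma ipC a b : l2 a -> l2 b -> ip b a = (ip a b)^*.
Proof.
move=> la lb; apply: ip_unique => //.
rewrite (_ : series _ = fun n => (series (fun k => a k * (b k)^* : cplx R) n)^*).
  by apply: cvg_conj; exact: ip_cvg.
apply/funext => n; rewrite /series /= rmorph_sum /=.
by apply: eq_bigr => k _; rewrite rmorphM /= conjCK mulrC.
Qed.

Lemma ipDr a b f : l2 a -> l2 b -> l2 f ->
  ip f (fun k => a k + b k) = ip f a + ip f b.
Proof.
move=> la lb lf; rewrite ipC ?ipDl //; last exact: l2D.
by rewrite rmorphD /= -!ipC.
Qed.

Lemma ipZr (c : cplx R) a f : l2 a -> l2 f -> ip f (fun k => c * a k) = c^* * ip f a.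
Proof.
move=> la lf; rewrite ipC ?ipZl //; last exact: l2Z.
by rewrite rmorphM /= -ipC.
Qed.

Lemma ipBl a b f : l2 a -> l2 b -> l2 f ->
  ip (fun k => a k - b k) f = ip a f - ip b f.
Proof.
move=> la lb lf; rewrite (_ : (fun k => _) = (fun k => a k + (-1) * b k)).
  by rewrite ipDl // ?ipZl ?mulN1r //; exact: l2Z.
by apply/funext => k; rewrite mulN1r.
Qed.

Lemma ipBr a b f : l2 a -> l2 b -> l2 f ->
  ip f (fun k => a k - b k) = ip f a - ip f b.
Proof.
move=> la lb lf; rewrite ipC ?ipBl //; last exact: l2B.
by rewrite rmorphB /= -!ipC.
Qed.

Lemma ip_sh a b : l2 a -> l2 b -> ip a (sh b) = ip (bk a) b.
Proof.
move=> la lb; apply: ip_unique => //; first exact: l2_sh.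
rewrite -(cvg_shiftS (series _)).
rewrite (_ : (fun n => _) = series (fun k => bk a k * (b k)^* : cplx R)).
  by apply: ip_cvg => //; exact: l2_bk.
apply/funext => n; rewrite /series /= big_nat_recl //=.
by rewrite conjC0 mulr0 add0r.
Qed.

Lemma ip_sh_sh a b : l2 a -> l2 b -> ip (sh a) (sh b) = ip a b.
Proof. by move=> la lb; rewrite ip_sh //; exact: l2_sh. Qed.

Lemma ip_sqn a : l2 a -> ip a a = (sqn a)%:C%C.
Proof.
move=> la; have := ipC la la; rewrite /sqn; case: (ip a a) => x y [] /eqP.
by rewrite -addr_eq0 -mulr2n mulrn_eq0 /= => /eqP ->.
Qed.

Lemma sqn_cvg a : l2 a -> series (fun k => nsq (a k)) @ \oo --> sqn a.
Proof.
move=> la; have := cvg_Re (ip_cvg la la).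
under eq_fun do rewrite Re_series.
have e : (fun k => Re (a k * (a k)^*)) = (fun k => nsq (a k)).
  by apply/funext => k; rewrite nsq_conj.
by rewrite e; apply.
Qed.

Lemma sum_le_sqn a n : l2 a -> \sum_(0 <= k < n) nsq (a k) <= sqn a.
Proof.
move=> la; have h := sqn_cvg la.
rewrite -(cvg_lim (@Rhausdorff R) h).
apply: nondecreasing_cvgn_le; last by apply/cvg_ex; eexists; exact: h.
by apply: nondecreasing_series => k _ _; exact: nsq_ge0.
Qed.

Lemma nsq_le_sqn a k : l2 a -> nsq (a k) <= sqn a.
Proof.
move=> la; apply: le_trans (sum_le_sqn k.+1 la).
by rewrite big_nat_recr //= lerDr sumr_ge0 // => *; exact: nsq_ge0.
Qed.

Lemma sqn_ge0 a : l2 a -> 0 <= sqn a.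
Proof. by move=> la; have := sum_le_sqn 0 la; rewrite big_geq. Qed.

Lemma sqn_eq0 a : l2 a -> sqn a = 0 -> a = fun=> 0.
Proof.
move=> la a0; apply/funext => k; apply/eqP; rewrite -nsq_eq0.
by rewrite eq_le nsq_ge0 andbT -a0 nsq_le_sqn.
Qed.

Lemma ip0l a : l2 a -> ip (fun=> 0) a = 0.
Proof.
move=> la; have := ipZl 0 la la; rewrite mul0r.
by rewrite (_ : (fun k => 0 * a k) = fun=> 0) //; apply/funext => k; rewrite mul0r.
Qed.

Lemma ip0r a : l2 a -> ip a (fun=> 0) = 0.
Proof. by move=> la; rewrite ipC ?ip0l ?conjC0 //; exact: l2_0. Qed.

Lemma sqnZ (c : cplx R) a : l2 a -> sqn (fun k => c * a k) = nsq c * sqn a.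
Proof.
move=> la; rewrite /sqn ipZl ?ipZr //; last exact: l2Z.
by rewrite mulrA nsq_conj ip_sqn // /= mulrC /=; rewrite mul0r subr0 mulrC.
Qed.

(** Expand the squared norm of s a - w b, where s = [sqn b] and w = [ip a b]: it equals s (s [sqn a]
    - |w|^2). If s = 0, then b vanishes. *)
Lemma ip_CS a b : l2 a -> l2 b -> nsq (ip a b) <= sqn a * sqn b.
Proof.
move=> la lb; have := sqn_ge0 lb; rewrite le_eqVlt => /predU1P[b0|b0].
  by rewrite (sqn_eq0 lb) // ip0r // nsq0 mulr_ge0 // sqn_ge0 //; exact: l2_0.
set w := ip a b; set s := sqn b.
have lsa := l2Z s%:C%C la; have lwb := l2Z w lb.
have := sqn_ge0 (l2B lsa lwb); rewrite {1}/sqn ipBl // ?ipBr //; last exact: l2B.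
rewrite !ipZl ?ipZr // -?/w (ipC la lb) -/w !ip_sqn // -/s.
have -> : Re (s%:C%C * ((s%:C)%C^* * (sqn a)%:C%C) - s%:C%C * (w^* * w) -
  (w * ((s%:C)%C^* * w^*) - w * (w^* * s%:C%C))) = s * (s * sqn a - nsq w).
  move: w {lwb} => w; case: w => x y; rewrite !conjE /nsq /=; ring.
by rewrite pmulr_rge0 // subr_ge0 mulrC.
Qed.

End SquareSummable.

(** * Power series and the Hardy space *)

Section PowerSeries.
Variable R : realType.
Implicit Types (a b f g h : nat -> cplx R) (z c x : cplx R).

(* Multiplication by z - c on Taylor coefficients, and its adjoint. *)
Definition Mz c g : nat -> cplx R := fun k => sh g k - c * g k.
Definition Tz c f : nat -> cplx R := fun k => f k.+1 - c^* * f k.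

(* Taylor coefficients of (x + z h(z)) / (1 - c z). *)
Fixpoint gs c x h (k : nat) : cplx R :=
  if k is j.+1 then c * gs c x h j + h j else x.

(** The defect is the squared modulus of (1 - t) x - t z, divided by t (1 - t). *)
Lemma nsqD_convex (t : R) x z : 0 < t < 1 ->
  nsq (x + z) <= nsq x / t + nsq z / (1 - t).
Proof.
move=> /andP[t0 t1]; have t1' : 0 < 1 - t by rewrite subr_gt0.
rewrite -subr_ge0.
have -> : nsq x / t + nsq z / (1 - t) - nsq (x + z) =
    nsq ((1 - t)%:C%C * x - t%:C%C * z) / (t * (1 - t)).
  case: x z => p q [r s]; rewrite /nsq /=; field.
  by rewrite !gt_eqF.
by rewrite divr_ge0 ?nsq_ge0 // mulr_ge0 // ltW.
Qed.

(** With t the mean of 1 and |c|^2, one has |c|^2 <= t^2, so the convexity bound turns the recursion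
    into S(n+1) <= t S(n) + K for the partial sums, where K = |x|^2 + M / (1 - t). The bound K / (1
    - t) is stable under this. *)
Lemma l2_gs c x h : nsq c < 1 -> l2 h -> l2 (gs c x h).
Proof.
move=> c1 [M hM]; set t := (1 + nsq c) / 2.
have c0 := nsq_ge0 c.
have t01 : 0 < t < 1 by apply/andP; split; rewrite /t; lra.
have /andP[t0 t1] := t01; have t1' : 0 < 1 - t by rewrite subr_gt0.
have ct : nsq c / t <= t.
  rewrite ler_pdivrMr // /t; have := sqr_ge0 (1 - nsq c); nra.
exists ((nsq x + M / (1 - t)) / (1 - t)); elim=> [|n IH].
  have M0 : 0 <= M by have := hM 0%N; rewrite big_geq.
  rewrite big_geq //; apply: divr_ge0; last exact: ltW.
  by apply: addr_ge0; [exact: nsq_ge0|apply: divr_ge0 => //; exact: ltW].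
rewrite big_nat_recl //=.
apply: (@le_trans _ _ (nsq x + \sum_(0 <= k < n) (t * nsq (gs c x h k) + nsq (h k) / (1 - t)))).
  rewrite lerD2l; apply: ler_sum => k _.
  apply: le_trans (nsqD_convex (c * gs c x h k) (h k) t01) _.
  rewrite lerD2r nsqM mulrAC; apply: ler_wpM2r => //; exact: nsq_ge0.
rewrite big_split /= -big_distrr -big_distrl /=.
have hM' : (\sum_(0 <= k < n) nsq (h k)) / (1 - t) <= M / (1 - t).
  by rewrite ler_pM2r ?invr_gt0.
move: IH; set S := \sum_(_ <= _ < _) _; set K := (_ + M / _) => IH.
apply: (@le_trans _ _ (t * (K / (1 - t)) + K)).
  have : t * S <= t * (K / (1 - t)) by rewrite ler_wpM2l // ltW.
  rewrite /K; move: hM'; lra.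
by rewrite le_eqVlt; apply/orP; left; apply/eqP; field; rewrite gt_eqF.
Qed.

(** The Szego kernel at z, the reproducing kernel of H^2: pairing with it evaluates a power series
    at z, so evaluation inherits the rules for [ip]. *)
Definition kz z : nat -> cplx R := fun k => z^* ^+ k.

Lemma kz_gs z : kz z = gs z^* 1 (fun=> 0).
Proof. by apply/funext; elim=> [|k IH]; rewrite /kz ?expr0 //= exprS addr0 -IH. Qed.

Lemma l2_kz z : nsq z < 1 -> l2 (kz z).
Proof. by move=> z1; rewrite kz_gs; apply: l2_gs (l2_0 R); rewrite nsqJ. Qed.

Definition ps a z : cplx R := ip a (kz z).

Lemma ps_series a z :
  series (fun k => a k * z ^+ k) = series (fun k => a k * (kz z k)^*).
Proof.
apply/funext => n; rewrite /series /=; apply: eq_bigr => k _.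
by rewrite /kz rmorphXn /= conjCK.
Qed.

Lemma ps_cvg a z : l2 a -> nsq z < 1 ->
  series (fun k => a k * z ^+ k) @ \oo --> ps a z.
Proof. by move=> la z1; rewrite ps_series; apply: ip_cvg => //; exact: l2_kz. Qed.

Lemma taylor_psP (F : cplx R -> cplx R) a : l2 a ->
  taylor_expansion F a <-> (forall z, nsq z < 1 -> F z = ps a z).
Proof.
move=> la; split=> [h z z1|h z].
  have := h z; rewrite unit_diskE => /(_ z1) /(cvg_lim (@norm_hausdorff _ _)) <-.
  by apply: (cvg_lim (@norm_hausdorff _ _)); exact: ps_cvg.
by rewrite unit_diskE => z1; rewrite h //; exact: ps_cvg.
Qed.

Lemma psD a b z : l2 a -> l2 b -> nsq z < 1 ->
  ps (fun k => a k + b k) z = ps a z + ps b z.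
Proof. by move=> la lb z1; rewrite /ps ipDl //; exact: l2_kz. Qed.

Lemma psB a b z : l2 a -> l2 b -> nsq z < 1 ->
  ps (fun k => a k - b k) z = ps a z - ps b z.
Proof. by move=> la lb z1; rewrite /ps ipBl //; exact: l2_kz. Qed.

Lemma psZ c a z : l2 a -> nsq z < 1 -> ps (fun k => c * a k) z = c * ps a z.
Proof. by move=> la z1; rewrite /ps ipZl //; exact: l2_kz. Qed.

Lemma ps_sh a z : l2 a -> nsq z < 1 -> ps (sh a) z = z * ps a z.
Proof.
move=> la z1; have lk := l2_kz z1.
rewrite /ps ipC ?ip_sh //; last exact: l2_sh.
have -> : bk (kz z) = fun k => z^* * kz z k.
  by apply/funext => k; rewrite /bk /kz exprS.
by rewrite ipZl // rmorphM /= conjCK -ipC.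
Qed.

Lemma l2_Mz c g : l2 g -> l2 (Mz c g).
Proof. by move=> lg; apply: l2B; [exact: l2_sh|exact: l2Z]. Qed.

Lemma l2_Tz c f : l2 f -> l2 (Tz c f).
Proof. by move=> lf; apply: l2B; [exact: l2_bk|exact: l2Z]. Qed.

Lemma ps_Mz c g z : l2 g -> nsq z < 1 -> ps (Mz c g) z = (z - c) * ps g z.
Proof.
move=> lg z1; rewrite psB ?psZ ?ps_sh ?mulrBl //; [exact: l2_sh|exact: l2Z].
Qed.

Lemma ip_Mz c f g : l2 f -> l2 g -> ip f (Mz c g) = ip (Tz c f) g.
Proof.
move=> lf lg; have [lsg lbf] := (l2_sh lg, l2_bk lf).
rewrite ipBr ?ipZr //; last exact: l2Z.
by rewrite ip_sh // [RHS]ipBl ?ipZl //; exact: l2Z.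
Qed.

Definition dl : nat -> cplx R := fun k => (k == 0%N)%:R.

Lemma l2_dl : l2 dl.
Proof.
exists 1 => -[|n]; first by rewrite big_geq.
rewrite big_nat_recl //= nsq1 big1 ?addr0 // => k _.
by rewrite nsq0.
Qed.

Lemma ip_dl a : l2 a -> ip a dl = a 0%N.
Proof.
move=> la; apply: ip_unique => //; first exact: l2_dl.
rewrite -(cvg_shiftS (series _)).
rewrite (_ : (fun n => _) = fun=> a 0%N); first exact: cvg_cst.
apply/funext => n; rewrite /series /= big_nat_recl //= conjC1 mulr1 big1 ?addr0 // => k _.
by rewrite conjC0 mulr0.
Qed.

Lemma ps_dl z : nsq z < 1 -> ps dl z = 1.
Proof.
move=> z1; have lk := l2_kz z1; rewrite /ps ipC ?ip_dl //; last exact: l2_dl.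
by rewrite /kz expr0 conjC1.
Qed.

Lemma ps_gs c x h z : nsq c < 1 -> l2 h -> nsq z < 1 ->
  (1 - c * z) * ps (gs c x h) z = x + z * ps h z.
Proof.
move=> c1 lh z1; have lg := l2_gs x c1 lh; have lcg := l2Z c lg.
have e : gs c x h = fun k => x * dl k + sh (fun k => c * gs c x h k + h k) k.
  by apply/funext => -[|k] /=; rewrite /dl /= ?mulr1 ?mulr0 ?addr0 ?add0r.
rewrite mulrBl mul1r {1}e psD ?psZ ?ps_sh ?psD ?psZ ?ps_dl //.
- ring.
- exact: l2D.
- exact: l2_dl.
- by apply: l2Z; exact: l2_dl.
- by apply: l2_sh; exact: l2D.
Qed.

Lemma ps_bk a z : l2 a -> nsq z < 1 -> ps a z = a 0%N + z * ps (bk a) z.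
Proof.
move=> la z1; have lb := l2_bk la.
have {1}-> : a = fun k => a 0%N * dl k + sh (bk a) k.
  by apply/funext => -[|k] /=; rewrite /dl /= ?mulr1 ?mulr0 ?addr0 ?add0r.
rewrite psD ?psZ ?ps_sh ?ps_dl ?mulr1 //.
- exact: l2_dl.
- by apply: l2Z; exact: l2_dl.
- exact: l2_sh.
Qed.

Lemma sqn_kz z : nsq z <= 1 / 4 -> sqn (kz z) <= 2.
Proof.
move=> z1; have z1' : nsq z < 1 by apply: le_lt_trans z1 _; lra.
have lk := l2_kz z1'; have h := sqn_cvg lk.
rewrite -(cvg_lim (@Rhausdorff R) h); apply: limr_le.
  by apply/cvg_ex; eexists; exact: h.
apply: nearW => n; rewrite /series /=; elim: n => [|n IH].
  by rewrite big_geq.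
rewrite big_nat_recl // /kz expr0 nsq1.
rewrite (eq_bigr (fun k => nsq z * nsq (kz z k))); last first.
  by move=> k _; rewrite exprS nsqM nsqJ.
rewrite -big_distrr /=.
have : nsq z * \sum_(0 <= k < n) nsq (kz z k) <= 1 / 4 * 2.
  by apply: ler_pM => //; [exact: nsq_ge0|apply: sumr_ge0 => *; exact: nsq_ge0].
lra.
Qed.

(** At a small real t, |b 0|^2 equals t^2 times the squared modulus of the tail's value, which stays
    bounded. Leaving z = 0 out of the hypothesis permits division by z, so the induction can pass to
    [bk a]. *)
Lemma ps_eq0 a : l2 a -> (forall z, z != 0 -> nsq z < 1 -> ps a z = 0) ->
  forall k, a k = 0.
Proof.
have main b : l2 b -> (forall z, z != 0 -> nsq z < 1 -> ps b z = 0) -> b 0%N = 0.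
  move=> lb b0; apply/eqP; rewrite -nsq_eq0 eq_le nsq_ge0 andbT leNgt.
  apply/negP => e0; have lbb := l2_bk lb.
  set e := nsq (b 0%N) in e0 *; set C := sqn (bk b) * 2.
  have C0 : 0 <= C by rewrite mulr_ge0 // sqn_ge0.
  have D0 : 0 < 2 * (e + C + 1) by nra.
  (* This t is below 1/2, as [sqn_kz] requires, and t^2 C < e. *)
  set t := e / (2 * (e + C + 1)).
  have t0 : 0 < t by rewrite divr_gt0.
  have tE : t * (2 * (e + C + 1)) = e by rewrite /t divfK // gt_eqF.
  have t2 : t < 1 / 2 by rewrite /t ltr_pdivrMr //; nra.
  have zt : nsq (t%:C%C : cplx R) <= 1 / 4 by rewrite nsq_real; nra.
  have zt1 : nsq (t%:C%C : cplx R) < 1 by apply: le_lt_trans zt _; lra.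
  have z0 : t%:C%C != 0 :> cplx R by rewrite -nsq_gt0 nsq_real exprn_gt0.
  have := ps_bk lb zt1; rewrite b0 // => /esym/eqP; rewrite addr_eq0 => /eqP.
  move=> /(congr1 (@nsq R)); rewrite nsqN nsqM nsq_real -/e => he.
  have := ip_CS lbb (l2_kz zt1); rewrite -/(ps _ _).
  have : sqn (bk b) * sqn (kz t%:C%C) <= C.
    by apply: ler_wpM2l; [exact: sqn_ge0|exact: sqn_kz].
  move=> h1 h2; have h3 := le_trans h2 h1.
  have : t ^+ 2 * nsq (ps (bk b) t%:C%C) <= t ^+ 2 * C by rewrite ler_wpM2l ?sqr_ge0.
  rewrite -he; nra.
move=> la a0 k; elim: k a la a0 => [|k IH] a la a0; first exact: main.
apply: (IH (bk a)); first exact: l2_bk.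
move=> z z0 z1; have := a0 z z0 z1; rewrite ps_bk // main // add0r.
by move/eqP; rewrite mulf_eq0 (negPf z0) => /eqP.
Qed.

Lemma ps_inj a b : l2 a -> l2 b -> (forall z, nsq z < 1 -> ps a z = ps b z) -> a = b.
Proof.
move=> la lb h; apply/funext => k; apply/eqP; rewrite -subr_eq0; apply/eqP.
apply: (ps_eq0 (l2B la lb)) => z _ z1.
by rewrite psB // h // subrr.
Qed.

Lemma taylor_bound (F : cplx R -> cplx R) a : taylor_expansion F a ->
  exists2 M : R, 0 <= M & forall k, nsq (a k) <= M * 4 ^+ k.
Proof.
have half : unit_disk (2^-1 : cplx R).
  by rewrite unit_diskE nsqV -[2](rmorph_nat (real_complex R)) nsq_real; lra.
move=> /(_ _ half) h; have : cvgn (series (fun k => a k * 2^-1 ^+ k : cplx R)).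
  by apply/cvg_ex; eexists; exact: h.
move=> /cvg_series_cvg_0 /cvg_nsq; rewrite nsq0 => h0.
have : cvgn (fun k => nsq (a k * 2^-1 ^+ k)) by apply/cvg_ex; eexists; exact: h0.
move=> /cvg_seq_bounded[M [_ Mb]].
exists (`|M| + 1); first by rewrite addr_ge0.
move=> k; have := Mb (`|M| + 1) _ k I; rewrite (le_lt_trans (ler_norm M)) ?ltrDl // => /(_ isT).
rewrite /= nsqM nsqX nsqV -[2](rmorph_nat (real_complex R)) nsq_real.
rewrite ger0_norm ?mulr_ge0 ?nsq_ge0 ?exprn_ge0 ?invr_ge0 ?sqr_ge0 //.
rewrite exprVn ler_pdivrMr ?exprn_gt0 //.
by rewrite (_ : 2 ^+ 2 = 4) // -natrX.
Qed.

Lemma taylor_unique (F : cplx R -> cplx R) a b :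
  taylor_expansion F a -> taylor_expansion F b -> a = b.
Proof.
(* Rescaling by 1/4 makes both coefficient sequences square summable. *)
pose q : cplx R := 4^-1.
have q2 : nsq q = 16^-1.
  rewrite /q nsqV -[4](rmorph_nat (real_complex R)) nsq_real.
  by rewrite -natrX.
have q0 : q != 0 by rewrite invr_eq0 pnatr_eq0.
have scale (d : nat -> cplx R) : taylor_expansion F d ->
    l2 (fun k => d k * q ^+ k) /\
    forall z, nsq z < 1 -> ps (fun k => d k * q ^+ k) z = F (q * z).
  move=> hc; have [M M0 cM] := taylor_bound hc.
  have lc : l2 (fun k => d k * q ^+ k).
    exists (M * 2) => n.
    have : \sum_(0 <= k < n) 4^-1 ^+ k <= 2 :> R.
      elim: n => [|n IH]; first by rewrite big_geq.
      rewrite big_nat_recl // expr0; under eq_bigr do rewrite exprS.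
      by rewrite -big_distrr /=; move: IH; lra.
    move=> h; apply: le_trans (ler_wpM2l M0 h); rewrite big_distrr /=.
    apply: ler_sum => k _; rewrite nsqM nsqX q2.
    apply: (@le_trans _ _ (M * 4 ^+ k * 16^-1 ^+ k)).
      by apply: ler_wpM2r => //; rewrite exprn_ge0 // invr_ge0.
    rewrite -mulrA -exprMn (_ : 4 * 16^-1 = 4^-1) //; lra.
  split=> // z z1.
  have qz : unit_disk (q * z) by rewrite unit_diskE nsqM q2; have := nsq_ge0 z; lra.
  rewrite -(cvg_lim (@norm_hausdorff _ _) (ps_cvg lc z1)).
  apply: (cvg_lim (@norm_hausdorff _ _)).
  have := hc _ qz; rewrite (_ : series (fun k => d k * (q * z) ^+ k) = series (fun k => d k * q ^+ k * z ^+ k)) //.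
  by apply/funext => n; rewrite /series /=; apply: eq_bigr => k _; rewrite exprMn mulrA.
move=> /scale[la ha] /scale[lb hb]; have /funeqP e : (fun k => a k * q ^+ k) = (fun k => b k * q ^+ k).
  by apply: ps_inj => // z z1; rewrite ha ?hb.
apply/funext => k; apply: (mulIf (expf_neq0 k q0)); exact: e.
Qed.

(** [xget] may return any expansion, square summable or not; uniqueness among all expansions pins it
    down. *)
Lemma taylor_coefE (F : cplx R -> cplx R) a :
  taylor_expansion F a -> taylor_coef F = a.
Proof.
move=> h; rewrite /taylor_coef; case: xgetP => [b -> hb|/(_ a)//].
exact: taylor_unique hb h.
Qed.

Lemma hdotE (F G : cplx R -> cplx R) a b :
  taylor_expansion F a -> taylor_expansion G b -> hdot F G = ip a b.
Proof. by move=> ha hb; rewrite /hdot (taylor_coefE ha) (taylor_coefE hb). Qed.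

Lemma l2_cvgP a : l2 a <-> cvgn (series (fun k => `|a k| ^+ 2 : cplx R)).
Proof.
have e : (fun k => `|a k| ^+ 2 : cplx R) = fun k => a k * (a k)^*.
  by apply/funext => k; rewrite nsq_norm nsq_conj.
split=> [la|]; first by rewrite e; apply/cvg_ex; eexists; exact: ip_cvg.
rewrite e => /cvg_Re h.
have {}h : series (fun k => nsq (a k)) @ \oo --> Re (limn (series (fun k => a k * (a k)^* : cplx R))).
  move: h; under eq_fun do rewrite Re_series.
  have {}e : (fun k => Re (a k * (a k)^*)) = (fun k => nsq (a k)).
    by apply/funext => k; rewrite nsq_conj.
  by rewrite e; apply.
exists (Re (limn (series (fun k => a k * (a k)^* : cplx R)))) => n.
rewrite -(cvg_lim (@Rhausdorff R) h).
apply: nondecreasing_cvgn_le; last by apply/cvg_ex; eexists; exact: h.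
by apply: nondecreasing_series => k _ _; exact: nsq_ge0.
Qed.

Lemma hardy2P (F : cplx R -> cplx R) :
  hardy2 F <-> exists2 a, l2 a & forall z, nsq z < 1 -> F z = ps a z.
Proof.
split=> [[a ha /l2_cvgP la]|[a la ha]].
  by exists a => //; exact/taylor_psP.
by exists a; [exact/taylor_psP|exact/l2_cvgP].
Qed.

End PowerSeries.

(** * The model space in Taylor coefficients *)

Section ModelSpace.
Variable R : realType.
Implicit Types (f g h : nat -> cplx R) (a b z c x : cplx R) (s : seq (cplx R)).

(* With P = \prod (z - a) and Q = \prod (1 - a^* z) over s: Ms and Ns multiply by
   P and Q, Gs divides by Q, and Ls is the adjoint of Ms. *)
Fixpoint Ls s f := if s is a :: s' then Ls s' (Tz a f) else f.
Fixpoint Ms s g := if s is a :: s' then Mz a (Ms s' g) else g.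
Fixpoint Ns s g :=
  if s is a :: s' then fun k => Ns s' g k - a^* * sh (Ns s' g) k else g.
Fixpoint Gs s g :=
  if s is a :: s' then gs a^* (Gs s' g 0%N) (bk (Gs s' g)) else g.

Definition in_disk s := forall a, a \in s -> nsq a < 1.

Lemma in_disk_cons (a : cplx R) s : in_disk (a :: s) -> nsq a < 1 /\ in_disk s.
Proof.
by move=> h; split=> [|b bs]; apply: h; rewrite inE ?eqxx ?bs ?orbT.
Qed.

Lemma in_disk_rcons (a : cplx R) s : in_disk (rcons s a) -> nsq a < 1 /\ in_disk s.
Proof.
by move=> h; split=> [|b bs]; apply: h; rewrite mem_rcons inE ?eqxx ?bs ?orbT.
Qed.

Lemma l2_Ls s f : l2 f -> l2 (Ls s f).
Proof. by elim: s f => //= a s IH f lf; apply: IH; exact: l2_Tz. Qed.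

Lemma l2_Ms s g : l2 g -> l2 (Ms s g).
Proof. by move=> lg; elim: s => //= a s IH; exact: l2_Mz. Qed.

Lemma l2_Ns s g : l2 g -> l2 (Ns s g).
Proof.
by move=> lg; elim: s => //= a s IH; apply: l2B => //; apply: l2Z; exact: l2_sh.
Qed.

Lemma l2_Gs s g : in_disk s -> l2 g -> l2 (Gs s g).
Proof.
move=> + lg; elim: s => //= a s IH /in_disk_cons[a1 s1].
by apply: l2_gs; [rewrite nsqJ|apply: l2_bk; exact: IH].
Qed.

Lemma ip_Ms s f g : l2 f -> l2 g -> ip f (Ms s g) = ip (Ls s f) g.
Proof.
move=> + lg; elim: s f => //= a s IH f lf.
by rewrite ip_Mz ?IH //; [exact: l2_Tz|exact: l2_Ms].
Qed.

Lemma ps_Ms s g z : l2 g -> nsq z < 1 ->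
  ps (Ms s g) z = \prod_(a <- s) (z - a) * ps g z.
Proof.
move=> lg z1; elim: s => [|a s IH] /=; first by rewrite big_nil mul1r.
by rewrite ps_Mz ?IH ?big_cons ?mulrA //; exact: l2_Ms.
Qed.

Lemma ps_Ns s g z : l2 g -> nsq z < 1 ->
  ps (Ns s g) z = \prod_(a <- s) (1 - a^* * z) * ps g z.
Proof.
move=> lg z1; elim: s => [|a s IH] /=; first by rewrite big_nil mul1r.
have lN := l2_Ns s lg; have lsN := l2_sh lN.
rewrite psB // ?psZ ?ps_sh ?IH ?big_cons //; last exact: l2Z.
ring.
Qed.

Lemma ps_Gs s g z : in_disk s -> l2 g -> nsq z < 1 ->
  \prod_(a <- s) (1 - a^* * z) * ps (Gs s g) z = ps g z.
Proof.
move=> + lg z1; elim: s => [_|a s IH /in_disk_cons[a1 s1]] /=.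
  by rewrite big_nil mul1r.
have lG := l2_Gs s1 lg.
rewrite big_cons mulrAC ps_gs ?nsqJ //; last exact: l2_bk.
by rewrite -ps_bk // mulrC IH.
Qed.

Lemma ip_shift_dl f m : l2 f -> l2 (iter m (@sh R) (dl R)) /\
  ip f (iter m (@sh R) (dl R)) = f m.
Proof.
elim: m f => [|m IH] f lf /=; first by split; [exact: l2_dl|exact: ip_dl].
have [ld e] := IH _ (l2_bk lf).
by split; [exact: l2_sh|rewrite ip_sh // e].
Qed.

Lemma blaschke_den_neq0 c z : nsq c < 1 -> nsq z <= 1 -> 1 - c^* * z != 0.
Proof.
move=> c1 z1; apply/eqP => /eqP; rewrite subr_eq0 => /eqP /(congr1 (@nsq R)).
rewrite nsq1 nsqM nsqJ => e.
have := nsq_ge0 c; have := nsq_ge0 z; nra.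
Qed.

(* As Q is invertible on H^2, Theta H^2 = P H^2, so f is in K_Theta iff the adjoint
   of the multiplication by P kills f. *)
Definition KS s f := l2 f /\ Ls s f = fun=> 0.

Lemma zeros_in_disk (Th : finBlaschke R) : in_disk (bl_zeros Th).
Proof. by move=> a /bl_zerosP; rewrite unit_diskE. Qed.

Lemma bl_funE (Th : finBlaschke R) z : nsq z <= 1 ->
  Th z * \prod_(a <- bl_zeros Th) (1 - a^* * z) =
  bl_const Th * \prod_(a <- bl_zeros Th) (z - a).
Proof.
move=> z1; rewrite /bl_fun -mulrA -big_split /=; congr (_ * _).
rewrite big_seq_cond [RHS]big_seq_cond; apply: eq_bigr => a /andP[az _].
by rewrite divfK //; apply: blaschke_den_neq0 => //; exact: zeros_in_disk az.
Qed.

Lemma prod_den_neq0 s z : in_disk s -> nsq z <= 1 ->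
  \prod_(a <- s) (1 - a^* * z) != 0.
Proof.
move=> + z1; elim: s => [_|a s IH /in_disk_cons[a1 s1]].
  by rewrite big_nil oner_neq0.
by rewrite big_cons mulf_neq0 ?IH // blaschke_den_neq0.
Qed.

Lemma bl_const_neq0 (Th : finBlaschke R) : bl_const Th != 0.
Proof. by rewrite -normr_gt0 bl_constP. Qed.

(** In one direction f is tested against Theta Q z^m, a unimodular multiple of P z^m, which reads
    off the coefficients of [Ls s f]. In the other, Theta h is a unimodular multiple of P (h / Q),
    and h / Q is in H^2. *)
Lemma model_spaceP (Th : finBlaschke R) (F : cplx R -> cplx R) :
  model_space Th F <-> exists2 f, KS (bl_zeros Th) f & taylor_expansion F f.
Proof.
set s := bl_zeros Th; have sd : in_disk s by exact: zeros_in_disk.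
split=> [[/hardy2P[f lf Ff] ort]|[f [lf Lf] Ff]].
  have Ft : taylor_expansion F f by exact/taylor_psP.
  exists f => //; split=> //; apply/funext => m.
  have [ld e] := ip_shift_dl m (l2_Ls s lf).
  have lN := l2_Ns s ld; have lM := l2_Ms s ld.
  have hh : hardy2 (ps (Ns s (iter m (@sh R) (dl R)))) by apply/hardy2P; eexists; first exact: lN.
  set D := iter m _ _ in ld e lN lM hh.
  have tE : taylor_expansion (fun z => Th z * ps (Ns s D) z)
      (fun k => bl_const Th * Ms s D k).
    apply/taylor_psP => [|z z1]; first exact: l2Z.
    rewrite psZ; [|exact: lM|exact: z1].
    rewrite ps_Ms; [|exact: ld|exact: z1].
    rewrite ps_Ns; [|exact: ld|exact: z1].
    by rewrite !mulrA; congr (_ * _); rewrite bl_funE // ltW.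
  have := ort _ hh; rewrite (hdotE Ft tE) ipZr; [|exact: lM|exact: lf].
  rewrite ip_Ms; [|exact: lf|exact: ld].
  rewrite e => /eqP; rewrite mulf_eq0 conjC_eq0.
  by rewrite (negPf (bl_const_neq0 Th)) => /eqP.
split; first by apply/hardy2P; exists f => //; exact/taylor_psP.
move=> H /hardy2P[h lh Hh].
have lG := l2_Gs sd lh; have lM := l2_Ms s lG.
have tE : taylor_expansion (fun z => Th z * H z)
    (fun k => bl_const Th * Ms s (Gs s h) k).
  apply/taylor_psP => [|z z1]; first exact: l2Z.
  rewrite psZ; [|exact: lM|exact: z1].
  rewrite ps_Ms; [|exact: lG|exact: z1].
  rewrite Hh // -(ps_Gs sd lh z1) mulrA mulrA; congr (_ * _).
  by rewrite bl_funE // ltW.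
rewrite (hdotE Ff tE) ipZr; [|exact: lM|exact: lf].
rewrite ip_Ms; [|exact: lf|exact: lG].
by rewrite Lf ip0l // mulr0.
Qed.

Lemma TzD c f g x k : Tz c (fun j => f j + x * g j) k = Tz c f k + x * Tz c g k.
Proof. by rewrite /Tz; ring. Qed.

Lemma LsD s f g x : Ls s (fun j => f j + x * g j) = fun k => Ls s f k + x * Ls s g k.
Proof.
elim: s f g => //= a s IH f g; rewrite -IH; congr Ls.
by apply/funext => k; exact: TzD.
Qed.

Lemma Ls_rcons s c f : Ls (rcons s c) f = Tz c (Ls s f).
Proof. by elim: s f => //= a s IH f. Qed.

Lemma KS_comb s f g x : KS s f -> KS s g -> KS s (fun j => f j + x * g j).
Proof.
move=> [lf f0] [lg g0]; split; first by apply: l2D => //; exact: l2Z.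
by rewrite LsD f0 g0; apply/funext => k; rewrite mulr0 addr0.
Qed.

Lemma KS0 s : KS s (fun=> 0).
Proof.
split; first exact: l2_0.
elim: s => //= a s IH; rewrite (_ : Tz _ _ = fun=> 0) //.
by apply/funext => k; rewrite /Tz mulr0 subr0.
Qed.

(** A preimage of f under [Ls s]: one factor [Tz a] is inverted at a time, with initial value 0. *)
Fixpoint sol s f : nat -> cplx R :=
  if s is a :: s' then gs a^* 0 (sol s' f) else f.

Lemma Tz_gs c x h : Tz c (gs c^* x h) = h.
Proof. by apply/funext => k; rewrite /Tz /= addrAC subrr add0r. Qed.

Lemma solP s f : in_disk s -> l2 f -> l2 (sol s f) /\ Ls s (sol s f) = f.
Proof.
move=> + lf; elim: s => //= a s IH /in_disk_cons[a1 s1].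
have [l1 e1] := IH s1; split; last by rewrite Tz_gs.
by apply: l2_gs => //; rewrite nsqJ.
Qed.

Lemma Tz_eq0 c f : Tz c f = (fun=> 0) -> f = fun k => f 0%N * kz c k.
Proof.
move=> /funeqP h; apply/funext; elim=> [|k IH]; first by rewrite /kz expr0 mulr1.
have /eqP := h k; rewrite /Tz /= subr_eq0 => /eqP ->; rewrite IH /kz exprS.
by rewrite mulrCA.
Qed.

(** For the longer list the adjoint is [Tz c] after [Ls s], and the kernel of [Tz c] is the line
    through [kz c]. So the space grows by at most one dimension, in the direction of a preimage of
    [kz c] under [Ls s]. *)
Lemma KS_rcons_split s c : in_disk (rcons s c) ->
  exists2 e, KS (rcons s c) e &
  forall f, KS (rcons s c) f -> exists x, KS s (fun k => f k + x * e k).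
Proof.
move=> /in_disk_rcons[c1 s1]; have [le Le] := solP s1 (l2_kz c1).
exists (sol s (kz c)).
  split=> //; rewrite Ls_rcons Le; apply/funext => k.
  by rewrite /Tz /kz exprS subrr.
move=> f [lf]; rewrite Ls_rcons => /Tz_eq0 h.
exists (- Ls s f 0%N); split; first by apply: l2D => //; exact: l2Z.
by rewrite LsD Le h; apply/funext => k; rewrite /kz expr0 mulr1 mulNr subrr.
Qed.

Lemma KS_rconsW s c f : KS s f -> KS (rcons s c) f.
Proof.
move=> [lf f0]; split=> //; rewrite Ls_rcons f0.
by apply/funext => k; rewrite /Tz mulr0 subr0.
Qed.

Definition lc m (y : nat -> cplx R) (e : nat -> nat -> cplx R) : nat -> cplx R :=
  fun k => \sum_(i < m) y i * e i k.

Lemma lcS m y e : lc m.+1 y e = fun k => lc m y e k + y m * e m k.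
Proof. by apply/funext => k; rewrite /lc big_ord_recr. Qed.

Lemma lc0 y e : lc 0 y e = fun=> 0.
Proof. by apply/funext => k; rewrite /lc big_ord0. Qed.

Lemma KS_lc s m y e : (forall i, (i < m)%N -> KS s (e i)) -> KS s (lc m y e).
Proof.
elim: m => [_|m IH he]; first by rewrite lc0; exact: KS0.
by rewrite lcS; apply: KS_comb; [apply: IH => i im; exact/he/ltnW|exact: he].
Qed.

Lemma l2_lc m y e : (forall i, (i < m)%N -> l2 (e i)) -> l2 (lc m y e).
Proof.
elim: m => [_|m IH he]; first by rewrite lc0; exact: l2_0.
by rewrite lcS; apply: l2D; [apply: IH => i im; exact/he/ltnW|apply: l2Z; exact: he].
Qed.

End ModelSpace.

(** * The numerical range of the compressed shift *)

Section NumericalRange.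
Variable R : realType.
Implicit Types (f g h : nat -> cplx R) (a b z c x : cplx R) (s : seq (cplx R)).
Implicit Types (y : nat -> cplx R) (e : nat -> nat -> cplx R).

Lemma ip_lcl m y e h : (forall i, (i < m)%N -> l2 (e i)) -> l2 h ->
  ip (lc m y e) h = \sum_(i < m) y i * ip (e i) h.
Proof.
move=> + lh; elim: m => [_|m IH he]; first by rewrite lc0 ip0l // big_ord0.
have lm : l2 (e m) by exact: he.
have hm i : (i < m)%N -> l2 (e i) by move=> im; exact/he/ltnW.
have ll := l2_lc y hm; have lz := l2Z (y m) lm.
by rewrite lcS ipDl // ipZl // IH // big_ord_recr.
Qed.

Lemma ip_lcr m y e h : (forall i, (i < m)%N -> l2 (e i)) -> l2 h ->
  ip h (lc m y e) = \sum_(i < m) (y i)^* * ip h (e i).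
Proof.
move=> he lh; rewrite ipC ?ip_lcl //; last exact: l2_lc.
rewrite rmorph_sum /=; apply: eq_bigr => i _.
by rewrite rmorphM /= -ipC //; exact: he.
Qed.

Definition onb s m e := [/\ forall i, (i < m)%N -> KS s (e i),
  forall i j, (i < m)%N -> (j < m)%N -> ip (e i) (e j) = (i == j)%:R &
  forall f, KS s f -> (forall i, (i < m)%N -> ip f (e i) = 0) -> f = fun=> 0].

Lemma ip_lc_onb s m e y j : onb s m e -> (j < m)%N -> ip (lc m y e) (e j) = y j.
Proof.
move=> [he ho _] jm; rewrite ip_lcl; last 2 first.
- by move=> i /he[].
- by have [] := he _ jm.
rewrite (bigD1 (Ordinal jm)) //= ho // eqxx mulr1 big1 ?addr0 // => i ij.
by rewrite ho // (negPf ij : (val i == j) = false) mulr0.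
Qed.

Lemma onb_expand s m e f : onb s m e -> KS s f ->
  f = lc m (fun i => ip f (e i)) e.
Proof.
move=> H kf; have [he ho hc] := H; set g := lc _ _ _.
have kg : KS s g by apply: KS_lc.
have [[lf _] [lg _]] := (kf, kg).
have /funeqP h : (fun k => f k + (-1) * g k) = fun=> 0.
  apply: hc => [|i im]; first exact: KS_comb.
  have [le _] := he _ im; have lz := l2Z (-1) lg.
  by rewrite ipDl // ipZl // (ip_lc_onb _ H) // mulN1r subrr.
by apply/funext => k; have /eqP := h k; rewrite mulN1r subr_eq0 => /eqP.
Qed.

Lemma onb_proj s m e f : onb s m e -> l2 f ->
  exists2 g, KS s g & forall h, KS s h -> ip (fun k => f k - g k) h = 0.
Proof.
move=> H lf; have [he _ _] := H; set g := lc m (fun i => ip f (e i)) e.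
have hl i : (i < m)%N -> l2 (e i) by move=> /he[].
have kg : KS s g by exact: KS_lc.
exists g => // h kh; have [lg _] := kg; rewrite (onb_expand H kh).
have lfg := l2B lf lg.
rewrite ip_lcr // big1 // => i _; have li := hl _ (ltn_ord i).
by rewrite ipBl // (ip_lc_onb _ H) // subrr mulr0.
Qed.

(** Gram-Schmidt, one zero at a time. [e'] is the new direction minus its projection; if it
    vanishes, the old basis is still complete. *)
Lemma onb_exists s : in_disk s -> exists m e, onb s m e.
Proof.
elim/last_ind: s => [_|s c IH sd].
  by exists 0%N, (fun _ _ => 0); split=> // f [].
have [_ s1] := in_disk_rcons sd; have [m [e H]] := IH s1; have [he ho hc] := H.
have hl i : (i < m)%N -> l2 (e i) by move=> /he[].
have [e0 k0 split0] := KS_rcons_split sd; have [l0 _] := k0.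
set p := lc m (fun i => ip e0 (e i)) e.
have kp : KS s p by exact: KS_lc.
have [lp _] := kp; set e' := fun k => e0 k + (-1) * p k.
have ke' : KS (rcons s c) e' by apply: KS_comb => //; exact: KS_rconsW.
have [le' _] := ke'.
have ort j : (j < m)%N -> ip e' (e j) = 0.
  move=> jm; have lj := hl _ jm; have lz := l2Z (-1) lp.
  by rewrite ipDl // ipZl // (ip_lc_onb _ H) // mulN1r subrr.
have split' f : KS (rcons s c) f -> exists x, KS s (fun k => f k + x * e' k).
  move=> /split0[x kx]; exists x.
  rewrite (_ : (fun k => _) = fun k => (f k + x * e0 k) + (- x) * p k).
    exact: KS_comb.
  by apply/funext => k; rewrite /e'; ring.
have ort' f : KS s f -> ip e' f = 0.
  move=> kf; rewrite (onb_expand H kf) ip_lcr // big1 // => i _.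
  by rewrite ort // mulr0.
have [e'0|e'0] := eqVneq (sqn e') 0.
  exists m, e; split=> //; first by move=> i im; exact/KS_rconsW/he.
  move=> f kf fo; apply: hc fo; have [x] := split' _ kf.
  rewrite (sqn_eq0 le' e'0) (_ : (fun k => _) = f) //.
  by apply/funext => k; rewrite mulr0 addr0.
have e'gt : 0 < sqn e' by rewrite lt_def e'0 sqn_ge0.
set t : cplx R := (Num.sqrt (sqn e'))^-1%:C%C.
have t0 : t != 0.
  by rewrite -nsq_gt0 nsq_real exprn_gt0 // invr_gt0 sqrtr_gt0.
have lt : l2 (fun k => t * e' k) by exact: l2Z.
have ort2 f : l2 f -> ip e' f = 0 -> ip f (fun k => t * e' k) = 0.
  by move=> lf ef; rewrite ipZr // ipC // ef conjC0 mulr0.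
exists m.+1, (fun i => if (i < m)%N then e i else fun k => t * e' k); split.
- move=> i im; case: ltnP => [/he /KS_rconsW//|mi].
  have := KS_comb t (KS0 (rcons s c)) ke'.
  by rewrite (_ : (fun j => _) = fun k => t * e' k) //; apply/funext => k; rewrite add0r.
- move=> i j; rewrite !ltnS leq_eqVlt => /orP[/eqP ->|im];
    rewrite leq_eqVlt => /orP[/eqP ->|jm].
  + rewrite ltnn eqxx ipZl // ipZr // ip_sqn // mulrA nsq_conj nsq_real.
    rewrite exprVn sqr_sqrtr ?ltW // -rmorphM /= mulVf //.
  + by rewrite ltnn jm gtn_eqF // ipZl ?ort ?mulr0 //; exact: hl.
  + by rewrite ltnn im ltn_eqF // ort2 ?ort //; exact: hl.
  + by rewrite im jm ho.
- move=> f kf fo; have [lf _] := kf.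
  have fi i : (i < m)%N -> ip f (e i) = 0.
    by move=> im; have := fo i (ltnW im); rewrite im.
  have := fo m (ltnSn m); rewrite ltnn ipZr // => /eqP.
  rewrite mulf_eq0 conjC_eq0 (negPf t0) /= => /eqP fe'.
  have [x kx] := split' _ kf; have [lx _] := kx; have le2 := l2Z x le'.
  have := ort' _ kx; rewrite ipDr // ipZr // ip_sqn // (ipC lf le') fe' conjC0 add0r.
  move=> /eqP; rewrite mulf_eq0 conjC_eq0 => /orP[/eqP x0|]; last first.
    by move=> /eqP /(congr1 (@complex.Re R)) /= /eqP; rewrite (negPf e'0).
  apply: hc fi; move: kx; rewrite x0 (_ : (fun k => _) = f) //.
  by apply/funext => k; rewrite mul0r addr0.
Qed.

(* The projection onto K_Theta may be dropped: <P (z f), f> = <z f, f>. *)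
Definition Wseq s : set (cplx R) :=
  [set ip (sh f) f | f in [set f | KS s f /\ sqn f = 1]].

Lemma compressed_shift_dot (Th : finBlaschke R) (F : cplx R -> cplx R) f :
  KS (bl_zeros Th) f -> taylor_expansion F f ->
  hdot (compressed_shift Th F) F = ip (sh f) f.
Proof.
move=> kf Ff; have [lf _] := kf; have lsf := l2_sh lf.
have zF : taylor_expansion (fun z => z * F z) (sh f).
  apply/taylor_psP => // z z1; rewrite ps_sh //; congr (_ * _).
  exact: (taylor_psP _ lf).1.
have diff (G : cplx R -> cplx R) g : l2 g -> taylor_expansion G g ->
    taylor_expansion ((fun z => z * F z) \- G) (fun k => sh f k - g k).
  move=> lg Gg; apply/taylor_psP => [|z z1]; first exact: l2B.
  by rewrite psB //= ((taylor_psP _ lsf).1 zF) // ((taylor_psP _ lg).1 Gg).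
(* Whatever [xget] returns leaves z F - G orthogonal to the model space, hence to F. The default
   branch is excluded because the projection built from an orthonormal basis is a candidate. *)
rewrite /compressed_shift /hproj; case: xgetP => [G _ [/model_spaceP[g kg Gg] ort]|].
  have [lg _] := kg.
  have mF : model_space Th F by apply/model_spaceP; exists f.
  have := ort _ mF; rewrite (hdotE (diff _ _ lg Gg) Ff) ipBl // (hdotE Gg Ff).
  by move/eqP; rewrite subr_eq0 => /eqP ->.
have [m [e H]] := onb_exists (@zeros_in_disk _ Th).
have [g kg gp] := onb_proj H lsf; have [lg _] := kg.
have Gg : taylor_expansion (ps g) g by exact/taylor_psP.
move=> /(_ (ps g)); case; split; first by apply/model_spaceP; exists g.
move=> K /model_spaceP[h kh Kh].
by rewrite (hdotE (diff _ _ lg Gg) Kh) gp.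
Qed.

Lemma W_shiftE (Th : finBlaschke R) : W_shift Th = Wseq (bl_zeros Th).
Proof.
apply/seteqP; split=> [w [F [mF nF] <-]|w [f [kf nf] <-]].
  have [f kf Ff] := (model_spaceP _ _).1 mF.
  rewrite (compressed_shift_dot kf Ff); exists f => //; split=> //.
  have := congr1 (fun z => z ^+ 2) nF.
  by rewrite /hnorm sqrtCK (hdotE Ff Ff) expr1n /sqn => ->.
have [lf _] := kf; have Ff : taylor_expansion (ps f) f by exact/taylor_psP.
exists (ps f); last exact: compressed_shift_dot.
split; first by apply/model_spaceP; exists f.
by rewrite /hnorm (hdotE Ff Ff) ip_sqn // nf sqrtC1.
Qed.

Lemma Wseq_disk s w : Wseq s w -> nsq w <= 1.
Proof.
move=> [f [[lf _] nf] <-]; have lsf := l2_sh lf.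
apply: le_trans (ip_CS lsf lf) _.
by rewrite nf mulr1 /sqn ip_sh_sh // ip_sqn // nf.
Qed.

Lemma Wseq_normalize s f w : KS s f -> sqn f != 0 ->
  ip (sh f) f = w * (sqn f)%:C%C -> Wseq s w.
Proof.
move=> kf f0 fw; have [lf _] := kf.
have fgt : 0 < sqn f by rewrite lt_def f0 sqn_ge0.
set t : cplx R := (Num.sqrt (sqn f))^-1%:C%C.
have t2 : nsq t * sqn f = 1.
  by rewrite nsq_real exprVn sqr_sqrtr ?ltW // mulVf.
have ltf := l2Z t lf; exists (fun k => t * f k); first split.
- have := KS_comb t (KS0 s) kf.
  by rewrite (_ : (fun j => _) = fun k => t * f k) //; apply/funext => k; rewrite add0r.
- by rewrite sqnZ.
- rewrite (_ : sh _ = fun k => t * sh f k).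
    rewrite ipZl ?ipZr //; try exact: l2_sh.
    rewrite fw mulrA nsq_conj mulrCA -rmorphM /= t2 ?mulr1 //.
  by apply/funext => -[|k] //=; rewrite mulr0.
Qed.

End NumericalRange.

(** * Compactness and connectedness of the numerical range *)

Section CompactConnected.
Variable R : realType.
Implicit Types (f g h : nat -> cplx R) (a b z c x w : cplx R) (s : seq (cplx R)).

Lemma cvg_sum_seq (K : numFieldType) (V : normedModType K) (T I : Type)
    (r : seq I) (F : set_system T) {FF : Filter F} (u : I -> T -> V) (l : I -> V) :
  (forall i, u i t @[t --> F] --> l i) ->
  \sum_(i <- r) u i t @[t --> F] --> \sum_(i <- r) l i.
Proof.
move=> h; elim: r => [|i r IH].
  by rewrite big_nil; under eq_fun do rewrite big_nil; exact: cvg_cst.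
rewrite big_cons; under eq_fun do rewrite big_cons.
by apply: cvgD; [exact: h|exact: IH].
Qed.

Lemma cvg_prod_seq (T : Type) (I : eqType) (r : seq I) (F : set_system T)
    {FF : Filter F} (u : I -> T -> cplx R) (l : I -> cplx R) :
  (forall i, i \in r -> u i t @[t --> F] --> l i) ->
  \prod_(i <- r) u i t @[t --> F] --> \prod_(i <- r) l i.
Proof.
elim: r => [_|i r IH h].
  by rewrite big_nil; under eq_fun do rewrite big_nil; exact: cvg_cst.
rewrite big_cons; under eq_fun do rewrite big_cons.
apply: cvgM; first by apply: h; rewrite mem_head.
by apply: IH => j jr; apply: h; rewrite inE jr orbT.
Qed.

Lemma bl_fun_continuous (B : finBlaschke R) z : nsq z <= 1 ->
  {for z, continuous B}.
Proof.
move=> z1; apply: cvgMr; first exact: (nbhs_filter z).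
refine (@cvg_prod_seq _ _ _ _ (nbhs_filter z)
  (fun a w => (w - a) / (1 - a^* * w)) (fun a => (z - a) / (1 - a^* * z)) _).
move=> a /zeros_in_disk a1.
apply: cvgM; first by apply: cvgB; [exact: cvg_id|exact: cvg_cst].
apply: cvgV; first exact: blaschke_den_neq0.
by apply: cvgB; [exact: cvg_cst|apply: cvgMr; exact: cvg_id].
Qed.

Lemma compact_square : compact [set z : cplx R | exists p : R * R,
  [/\ -1 <= p.1 <= 1, -1 <= p.2 <= 1 & z = Complex p.1 p.2]].
Proof.
have K : compact (`[(-1 : R), 1]%classic `*` `[(-1 : R), 1]%classic).
  by apply: compact_setX; exact: segment_compact.
have C : continuous (fun p : R * R => Complex p.1 p.2 : cplx R).
  by move=> p; apply: cvg_complex; [exact: cvg_fst|exact: cvg_snd].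
have := continuous_compact (continuous_subspaceT C) K.
set A := _ @` _; set A' := [set _ | _]; suff -> : A' = A by [].
apply/seteqP; split=> z [p].
  by move=> [h1 h2 ->]; exists p => //; split; rewrite /= in_itv.
by move=> [/= + + <-]; rewrite !in_itv /= => h1 h2; exists p.
Qed.

Lemma disk_square z : nsq z <= 1 -> exists p : R * R,
  [/\ -1 <= p.1 <= 1, -1 <= p.2 <= 1 & z = Complex p.1 p.2].
Proof.
case: z => x y; rewrite /nsq /= => h; exists (x, y); split => //=; apply/andP; split; nra.
Qed.

Definition lcv m (v : 'rV[cplx R]_m) : nat -> cplx R :=
  fun i => if insub i is Some j then v ord0 j else 0.

Lemma lcvE m (v : 'rV[cplx R]_m) (i : 'I_m) : lcv v i = v ord0 i.
Proof. by rewrite /lcv valK. Qed.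

Definition qform (m : nat) (A : nat -> nat -> cplx R) (v : 'rV[cplx R]_m) : cplx R :=
  \sum_(i < m) v ord0 i * \sum_(j < m) (v ord0 j)^* * A i j.

Lemma cvg_qform (T : Type) (F : set_system T) {FF : Filter F} m A
    (u : T -> 'rV[cplx R]_m) (v : 'rV[cplx R]_m) :
  (forall i, u t ord0 i @[t --> F] --> v ord0 i) ->
  qform A (u t) @[t --> F] --> qform A v.
Proof.
move=> h; apply: cvg_sum_seq => i; apply: cvgM; first exact: h.
by apply: cvg_sum_seq => j; apply: cvgMl; apply: cvg_conj; exact: h.
Qed.

Lemma qform_continuous m A : continuous (@qform m A).
Proof.
move=> v; apply: (@cvg_qform _ _ (nbhs_filter v)) => i; exact: coord_continuous.
Qed.

Definition nform (m : nat) (v : 'rV[cplx R]_m) : R := \sum_(i < m) nsq (v ord0 i).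

Lemma cvg_nform (T : Type) (F : set_system T) {FF : Filter F} m
    (u : T -> 'rV[cplx R]_m) (v : 'rV[cplx R]_m) :
  (forall i, u t ord0 i @[t --> F] --> v ord0 i) ->
  nform (u t) @[t --> F] --> nform v.
Proof. by move=> h; apply: cvg_sum_seq => i; apply: cvg_nsq; exact: h. Qed.

Lemma nform_continuous m : continuous (@nform m).
Proof.
move=> v; apply: (@cvg_nform _ _ (nbhs_filter v)) => i; exact: coord_continuous.
Qed.

Lemma compact_sphere m : compact [set v : 'rV[cplx R]_m | nform v = 1].
Proof.
apply: (subclosed_compact _ (@rV_compact _ m (fun=> _) (fun=> compact_square))).
  have := @closed_comp _ _ (@nform m) [set x : R | x = 1].
  by apply; [move=> v _; exact: nform_continuous|exact: closed_eq].
move=> v /= v1 i; apply: disk_square; rewrite -v1 /nform (bigD1 i) //= lerDl.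
by apply: sumr_ge0 => j _; exact: nsq_ge0.
Qed.

(** In orthonormal coordinates the numerical range is the image of the compact unit sphere under a
    continuous form; its compactness enters in this way. *)
Lemma Wseq_qform s m e w : onb s m e ->
  Wseq s w <-> exists2 v : 'rV[cplx R]_m, nform v = 1 &
    w = qform (fun i j => ip (sh (e i)) (e j)) v.
Proof.
move=> H; have [he ho _] := H.
have hl i : (i < m)%N -> l2 (e i) by move=> /he[].
have hs i : (i < m)%N -> l2 (sh (e i)) by move=> /hl; exact: l2_sh.
have shE y : sh (lc m y e) = lc m y (fun i => sh (e i)).
  apply/funext => -[|k] //=.
  by rewrite /lc big1 // => i _; rewrite mulr0.
have q (y : nat -> cplx R) (v : 'rV[cplx R]_m) : (forall i : 'I_m, y i = v ord0 i) ->
    sqn (lc m y e) = nform v /\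
    ip (sh (lc m y e)) (lc m y e) = qform (fun i j => ip (sh (e i)) (e j)) v.
  move=> yv; have ll := l2_lc y hl; split.
    apply: complexI; rewrite -ip_sqn // ip_lcl // /nform rmorph_sum /=.
    apply: eq_bigr => i _; rewrite ip_lcr //; last exact: hl.
    rewrite (bigD1 i) //= ho // eqxx mulr1 big1 ?addr0; last first.
      move=> j ji; rewrite ho //.
      by rewrite eq_sym (negPf ji : (val j == val i) = false) mulr0.
    by rewrite yv nsq_conj.
  rewrite shE ip_lcl //; apply: eq_bigr => i _; rewrite yv; congr (_ * _).
  by rewrite ip_lcr //; [apply: eq_bigr => j _; rewrite yv|exact: hs].
split=> [[f [kf f1] <-]|[v v1 ->]].
  pose v : 'rV[cplx R]_m := \row_(i < m) ip f (e i).
  have vE (i : 'I_m) : ip f (e i) = v ord0 i by rewrite mxE.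
  have [h1 h2] := q (fun i => ip f (e i)) v vE.
  by exists v; rewrite -?h1 -?h2 -(onb_expand H kf).
have [h1 h2] := q (lcv v) v (@lcvE _ v).
by exists (lc m (lcv v) e) => //; split; [exact: KS_lc|rewrite h1].
Qed.

Lemma bl_max_exists (Th B : finBlaschke R) : W_shift Th !=set0 ->
  exists2 z, W_shift Th z & forall w, W_shift Th w -> nsq (B w) <= nsq (B z).
Proof.
rewrite W_shiftE => -[w0 W0].
have [m [e H]] := onb_exists (@zeros_in_disk _ Th).
pose q := qform (m := m) (fun i j => ip (sh (e i)) (e j)).
have [v0 v01 _] := (Wseq_qform w0 H).1 W0.
have cont : {within [set v : 'rV[cplx R]_m | nform v = 1],
    continuous (fun v => nsq (B (q v)))}.
  apply: continuous_in_subspaceT => v; rewrite inE /= => v1.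
  have W1 : Wseq (bl_zeros Th) (q v) by apply/(Wseq_qform _ H); exists v.
  have cB := @bl_fun_continuous B _ (Wseq_disk W1).
  apply: (@cvg_nsq _ _ _ (nbhs_filter v)).
  exact: (@cvg_comp _ _ _ q B (nbhs v) (nbhs (q v)) (nbhs (B (q v)))
    (@qform_continuous _ _ v) cB).
have [|v vA vm] := compact_EVT_max _ (@compact_sphere m) cont; first by exists v0.
exists (q v); first by apply/(Wseq_qform _ H); exists v => //; move: vA; rewrite inE.
move=> w /(Wseq_qform _ H)[u u1 ->]; apply: vm; by rewrite inE.
Qed.

(** As the maximum is attained, every case reduces to finding one point of the numerical range with
    |B|^2 >= 1/4. *)
Lemma is_max_of_ge_half (Th B : finBlaschke R) z : W_shift Th z ->
  4^-1 <= nsq (B z) ->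
  exists2 M : cplx R, is_max [set `|B z| | z in W_shift Th] M & 2^-1 <= M.
Proof.
move=> Wz Bz; have [|z0 W0 m0] := @bl_max_exists Th B; first by exists z.
exists `|B z0|.
  by split; [exists z0|move=> _ [w Ww <-]; rewrite ler_nsq; exact: m0].
rewrite (_ : 2^-1 = (2^-1 : R)%:C%C); last by rewrite fmorphV rmorph_nat.
rewrite ger_nsqr ?invr_ge0 //; apply: le_trans (m0 _ Wz).
by rewrite exprVn -natrX.
Qed.

(** Connectedness in the form in which it is applied. The segment [F] from [f0] to [f1], normalized,
    traces a path [g] in the numerical range from [w0] to [w1], along which the real intermediate
    value theorem is used. *)
Lemma Wseq_ivt s w0 w1 (phi : cplx R -> R) (v : R) :
  Wseq s w0 -> Wseq s w1 ->
  (forall w, Wseq s w -> {for w, continuous phi}) ->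
  phi w0 <= v -> v <= phi w1 -> exists2 w, Wseq s w & phi w = v.
Proof.
move=> W0 W1 cphi v0 v1.
have [f0 [k0 n0] e0] := W0; have [f1 [k1 n1] e1] := W1.
have [[l0 _] [l1 _]] := (k0, k1).
pose F (t : R) : nat -> cplx R := fun k => (1 - t)%:C%C * f0 k + t%:C%C * f1 k.
have kF t : KS s (F t).
  have := KS_comb t%:C%C (KS_comb (1 - t)%:C%C (KS0 s) k0) k1.
  rewrite (_ : (fun k => _) = F t) //.
  by apply/funext => k; rewrite add0r.
have lF t : l2 (F t) by have [] := kF t.
have shF t : sh (F t) = fun k => (1 - t)%:C%C * sh f0 k + t%:C%C * sh f1 k.
  by apply/funext => -[|k] //=; rewrite !mulr0 addr0.
have [[ls0 ls1] [z0 z1]] := ((l2_sh l0, l2_sh l1), (fun t : R => l2Z (1 - t)%:C%C l0,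
  fun t : R => l2Z t%:C%C l1)).
have [y0 y1] := (fun t : R => l2Z (1 - t)%:C%C ls0, fun t : R => l2Z t%:C%C ls1).
(* If the segment passes through 0, then [f0] is a multiple of [f1], unimodular because both have
   norm one, and so [w0 = w1]. *)
have [F0|Fn0] := pselect (exists2 t, 0 <= t <= 1 & sqn (F t) = 0).
  have [t t01 /(sqn_eq0 (lF t))/funeqP Ft] := F0.
  suff e : w0 = w1 by exists w0 => //; apply/eqP; rewrite eq_le v0 e v1.
  have t1 : 1 - t != 0.
    apply/eqP => t1; have f10 : f1 = fun=> 0.
      apply/funext => k; have := Ft k; rewrite /F t1.
      have -> : t = 1 by lra.
      by rewrite mul0r add0r mul1r.
    by move: n1; rewrite f10 /sqn ip0l => [/= /eqP|]; [rewrite eq_sym oner_eq0|exact: l2_0].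
  set c : cplx R := - (t / (1 - t))%:C%C.
  have fE : f0 = fun k => c * f1 k.
    apply/funext => k; have := Ft k; rewrite /F => /eqP; rewrite addr_eq0 => /eqP h.
    have t1' : (1 - t)%:C%C != 0 :> cplx R by rewrite -nsq_gt0 nsq_real exprn_even_gt0.
    apply: (mulfI t1'); rewrite h /c mulrA mulrN -rmorphM /=.
    by rewrite (mulrC (1 - t)) divfK // mulNr.
  have c1 : nsq c = 1 by move: n0; rewrite fE sqnZ // n1 mulr1.
  rewrite -e0 fE (_ : sh _ = fun k => c * sh f1 k); last first.
    by apply/funext => -[|k] //=; rewrite mulr0.
  by rewrite ipZl ?ipZr // ?mulrA ?nsq_conj ?c1 ?mul1r //; exact: l2Z.
pose G (t : R) : cplx R := ip (sh (F t)) (F t).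
pose g (t : R) : cplx R := G t * ((sqn (F t))^-1)%:C%C.
pose Q (A B C D : cplx R) (t : R) : cplx R :=
  (1 - t)%:C%C * ((1 - t)%:C%C * A + t%:C%C * B) +
  t%:C%C * ((1 - t)%:C%C * C + t%:C%C * D).
have quad (h0 h1 : nat -> cplx R) : l2 h0 -> l2 h1 ->
    forall t, ip (fun k => (1 - t)%:C%C * h0 k + t%:C%C * h1 k) (F t) =
    Q (ip h0 f0) (ip h0 f1) (ip h1 f0) (ip h1 f1) t.
  move=> lh0 lh1 t; have [q0 q1] := (l2Z (1 - t)%:C%C lh0, l2Z t%:C%C lh1).
  have rc (r : R) : (r%:C%C : cplx R)^* = r%:C%C by rewrite conjE oppr0.
  have [p0 p1] := (z0 t, z1 t); have lFt := lF t.
  by rewrite ipDl // !ipZl // /F !ipDr // !ipZr // !rc.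
have cC (r : R) : {for r, continuous (fun t : R => t%:C%C : cplx R)}.
  apply: cvg_complex => /=; [exact: cvg_id|exact: cvg_cst].
have cC' (r : R) : {for r, continuous (fun t : R => (1 - t)%:C%C : cplx R)}.
  apply: cvg_complex => /=; last exact: cvg_cst.
  by apply: cvgB; [exact: cvg_cst|exact: cvg_id].
have cquad (A B C D : cplx R) (r : R) : {for r, continuous (Q A B C D)}.
  apply: cvgD; apply: cvgM; [exact: cC'| |exact: cC|]; apply: cvgD; apply: cvgMl;
    by [exact: cC|exact: cC'].
have cG r : {for r, continuous G}.
  have GE : G = Q (ip (sh f0) f0) (ip (sh f0) f1) (ip (sh f1) f0) (ip (sh f1) f1).
    by apply/funext => t; rewrite /G shF quad.
  rewrite GE; exact: cquad.
have cN r : {for r, continuous (fun t => sqn (F t))}.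
  have NE : (fun t => ip (F t) (F t)) =
      Q (ip f0 f0) (ip f0 f1) (ip f1 f0) (ip f1 f1).
    by apply/funext => t; rewrite {1}/F quad.
  have cI : {for r, continuous (fun t => ip (F t) (F t))}.
    by rewrite NE; exact: cquad.
  exact: cvg_Re cI.
have Wg t : 0 <= t <= 1 -> Wseq s (g t).
  move=> t01; have n : sqn (F t) != 0 by apply/eqP => n; apply: Fn0; exists t.
  apply: (Wseq_normalize (kF t) n).
  by rewrite /g -mulrA -rmorphM /= mulVf // mulr1.
have cg t : 0 <= t <= 1 -> {for t, continuous g}.
  move=> t01; have n : sqn (F t) != 0 by apply/eqP => n; apply: Fn0; exists t.
  apply: cvgM; first exact: cG.
  apply: cvg_complex => /=; last exact: cvg_cst.
  by apply: cvgV => //; exact: cN.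
have F0 : F 0 = f0 by apply/funext => k; rewrite /F subr0 mul1r mul0r addr0.
have F1 : F 1 = f1 by apply/funext => k; rewrite /F subrr mul1r mul0r add0r.
have g0 : g 0 = w0 by rewrite /g /G F0 n0 e0 invr1 mulr1.
have g1 : g 1 = w1 by rewrite /g /G F1 n1 e1 invr1 mulr1.
have [||t] := @IVT R (phi \o g) 0 1 v ler01.
- apply: continuous_in_subspaceT => t; rewrite inE /= in_itv /= => t01.
  by apply: continuous_comp; [exact: cg|apply: cphi; exact: Wg].
- by rewrite /= g0 g1 min_l ?max_r ?v0 // (le_trans v0).
by rewrite in_itv /= => t01 <-; exists (g t) => //; exact: Wg.
Qed.

End CompactConnected.

(** * Chords of the inscribed polygon *)

Section Chords.
Variable R : realType.
Implicit Types (f g h : nat -> cplx R) (a b z c x w : cplx R) (s : seq (cplx R)).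

Definition Qpoly s : {poly cplx R} := \prod_(a <- s) (1 - a^* *: 'X).
Definition Ppoly s : {poly cplx R} := \prod_(a <- s) ('X - a%:P).
Definition Npoly s : {poly cplx R} := Qpoly s - 'X * Ppoly s.

Lemma hornerQ s z : (Qpoly s).[z] = \prod_(a <- s) (1 - a^* * z).
Proof. by rewrite horner_prod; apply: eq_bigr => a _; rewrite !hornerE. Qed.

Lemma hornerP s z : (Ppoly s).[z] = \prod_(a <- s) (z - a).
Proof. by rewrite horner_prod; apply: eq_bigr => a _; rewrite !hornerE. Qed.

Lemma hornerN s z : (Npoly s).[z] =
  \prod_(a <- s) (1 - a^* * z) - z * \prod_(a <- s) (z - a).
Proof. by rewrite /Npoly hornerD hornerN hornerM hornerX hornerQ hornerP. Qed.

Lemma size_Ppoly s : size (Ppoly s) = (size s).+1.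
Proof. exact: size_prod_XsubC. Qed.

Lemma size_Qpoly s : (size (Qpoly s) <= (size s).+1)%N.
Proof.
rewrite /Qpoly; elim: s => [|a s IH]; first by rewrite big_nil size_poly1.
rewrite big_cons; apply: leq_trans (size_polyMleq _ _) _.
have h : (size (1 - a^* *: 'X : {poly cplx R})%R <= 2)%N.
  apply: leq_trans (size_polyD _ _) _; rewrite geq_max size_poly1 size_polyN /=.
  by apply: leq_trans (size_scale_leq _ _) _; rewrite size_polyX.
have /= := leq_add h IH; by case: (_ + _)%N.
Qed.

Lemma size_Npoly s : size (Npoly s) = (size s).+2.
Proof.
have sP : size ('X * Ppoly s) = (size s).+2.
  by rewrite mulrC size_mulX -?size_poly_gt0 size_Ppoly.
by rewrite /Npoly addrC size_polyDl size_polyN sP // ltnS size_Qpoly.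
Qed.

Lemma pseudo_identity a z :
  nsq (1 - a^* * z) - nsq (z - a) = (1 - nsq a) * (1 - nsq z).
Proof. by case: a z => p q [r t]; rewrite conjE /nsq /=; ring. Qed.

Lemma prod_pseudo_le s z : in_disk s -> nsq z <= 1 ->
  \prod_(a <- s) nsq (z - a) <= \prod_(a <- s) nsq (1 - a^* * z).
Proof.
move=> sd z1; rewrite big_seq [X in _ <= X]big_seq.
apply: ler_prod => a /sd a1; rewrite nsq_ge0 /= -subr_ge0 pseudo_identity.
by rewrite mulr_ge0 // subr_ge0 // ltW.
Qed.

Lemma prod_pseudo_ge s z : in_disk s -> 1 <= nsq z ->
  \prod_(a <- s) nsq (1 - a^* * z) <= \prod_(a <- s) nsq (z - a).
Proof.
move=> sd z1; rewrite big_seq [X in _ <= X]big_seq.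
apply: ler_prod => a /sd a1; rewrite nsq_ge0 /= -subr_le0 pseudo_identity.
by rewrite mulr_ge0_le0 // ?subr_le0 // subr_ge0 ltW.
Qed.

(** A root satisfies |Q| = |z| |P|. Inside the circle |P| <= |Q| and Q is nonzero; outside it |Q| <=
    |P| and P is nonzero. Either contradicts the equality. *)
Lemma Npoly_root s z : in_disk s -> root (Npoly s) z -> nsq z = 1.
Proof.
move=> sd; rewrite /root hornerN subr_eq0 => /eqP /(congr1 (@nsq R)).
rewrite nsqM !nsq_prod => e; have [z1|z1|//] := ltgtP (nsq z) 1.
  have Q0 : 0 < \prod_(a <- s) nsq (1 - a^* * z).
    by rewrite -nsq_prod nsq_gt0 prod_den_neq0 // ltW.
  have := prod_pseudo_le sd (ltW z1); rewrite leNgt; case/negP.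
  rewrite {1}e; have := nsq_ge0 z; move: e Q0.
  set A := \prod_(_ <- _) _; set B := \prod_(_ <- _) _ => e Q0 z0.
  nra.
have P0 : 0 < \prod_(a <- s) nsq (z - a).
  rewrite -nsq_prod nsq_gt0 prodf_seq_neq0; apply/allP => a /sd a1; apply/implyP => _.
  by rewrite subr_eq0; apply/eqP => za; move: z1; rewrite za ltNge ltW.
have := prod_pseudo_ge sd (ltW z1); rewrite e => h.
have : nsq z * \prod_(a <- s) nsq (z - a) > \prod_(a <- s) nsq (z - a).
  by rewrite ltr_pMl.
by rewrite ltNge h.
Qed.

(** Write Q_s for the product over the tail. As Q_s(0) = 1, r - r(0) Q_s = z r', so the quotient is
    (r(0) + z r' / Q_s) / (1 - conj(a) z), which [gs] computes; [Tz a] brings it back to r' /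
    Q_s. *)
Lemma KS_quotient s (r : {poly cplx R}) : in_disk s -> (size r <= size s)%N ->
  exists2 f, KS s f & forall z, nsq z < 1 -> (Qpoly s).[z] * ps f z = r.[z].
Proof.
elim: s r => [|a s IH] r.
  move=> _; rewrite leqn0 size_poly_eq0 => /eqP ->; exists (fun=> 0); first exact: KS0.
  move=> z z1; have lk := l2_kz z1.
  by rewrite horner0 /ps ip0l // mulr0.
move=> /in_disk_cons[a1 s1] rs; set x := r.[0].
have /factor_theorem[r'] : root (r - x *: Qpoly s) 0.
  rewrite /root !hornerE hornerQ big1 ?mulr1 ?subrr // => b _.
  by rewrite mulr0 subr0.
rewrite subr0 => rE.
have rs' : (size r' <= size s)%N.
  have [->|r'0] := eqVneq r' 0; first by rewrite size_poly0.
  rewrite -ltnS -size_mulX // -rE; apply: leq_trans (size_polyD _ _) _.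
  rewrite geq_max rs size_polyN /=; apply: leq_trans (size_scale_leq _ _) _.
  exact: size_Qpoly.
have [h kh hE] := IH r' s1 rs'; have [lh Lh] := kh.
exists (gs a^* x h).
  split; last by rewrite /= Tz_gs.
  by apply: l2_gs => //; rewrite nsqJ.
move=> z z1; have := ps_gs x (_ : nsq a^* < 1) lh z1; rewrite nsqJ => /(_ a1) e.
have -> : r = x *: Qpoly s + r' * 'X by rewrite -rE addrC subrK.
rewrite !hornerE -hE // [Qpoly (_ :: _)]/Qpoly big_cons -/(Qpoly s) !hornerE.
rewrite mulrAC e; ring.
Qed.

(** With F = (z - p) f and G = (z - q) f, (z - q) F is 1 - z P / Q. As |q| = 1 and the shift is an
    isometry, <G, F> is a multiple of <z f, 1 - z P / Q> = - <f, P / Q>, which is 0 for f in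
    K_Theta. *)
Lemma chord_in_Wseq s p q (r : {poly cplx R}) : in_disk s ->
  Npoly s = ('X - p%:P) * (('X - q%:P) * r) ->
  exists2 t : R, 0 <= t <= 1 & Wseq s (t%:C%C * p + (1 - t)%:C%C * q).
Proof.
move=> sd NE.
have r0 : r != 0.
  apply/eqP => r0; have := size_Npoly s; rewrite NE r0 !mulr0 size_poly0 //.
have rs : (size r <= size s)%N.
  have := size_Npoly s; rewrite NE.
  rewrite !size_mul ?mulf_neq0 ?polyXsubC_eq0 // !size_XsubC /= !addSn !add0n /=.
  by move=> [->].
have q1 : nsq q = 1.
  by apply: (Npoly_root sd); rewrite NE !rootM !root_XsubC eqxx orbT.
have qq : q^* * q = 1 by rewrite mulrC nsq_conj q1.
have [f kf fE] := KS_quotient sd rs; have [lf Lf] := kf.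
have lG0 := l2_Gs sd (l2_dl R); have lth := l2_Ms s lG0.
set th := Ms s (Gs s (dl R)) in lth.
have lF := l2_Mz p lf; have lG := l2_Mz q lf; have lsf := l2_sh lf.
set F := Mz p f in lF; set G := Mz q f in lG.
have lsF := l2_sh lF; have lsth := l2_sh lth.
have FE : Mz q F = fun k => dl R k - sh th k.
  apply: ps_inj; [exact: l2_Mz|by apply: l2B => //; exact: l2_dl|] => z z1.
  rewrite !ps_Mz // psB ?ps_dl ?ps_sh ?ps_Ms //; last exact: l2_dl.
  have Q0 := prod_den_neq0 sd (ltW z1); apply: (mulfI Q0).
  have := congr1 (horner ^~ z) NE; rewrite hornerN !hornerM !hornerXsubC -fE // hornerQ.
  have := ps_Gs sd (l2_dl R) z1; rewrite ps_dl //.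
  set Q := \prod_(_ <- _) _; set P := \prod_(_ <- _) _ => e1 e2.
  rewrite mulrBr mulr1 (mulrCA Q z) (mulrCA Q P) e1 mulr1 e2; ring.
have GF0 : ip G F = 0.
  have -> : ip G F = ip (sh f) (fun k => (- q^*) * Mz q F k).
    have qE : (fun k => (- q^*) * Mz q F k) = fun k => F k - q^* * sh F k.
      apply/funext => k; rewrite [Mz q F k]/Mz.
      by rewrite -[X in _ = X - _]mul1r -qq; ring.
    have [l1 l2'] := (l2Z q lf, l2Z q^* lsF).
    rewrite qE [RHS]ipBr // [X in _ = _ - X]ipZr // conjCK ip_sh_sh //.
    by rewrite [LHS]ipBl // ipZl //.
  rewrite ipZr ?FE //; last by rewrite -FE; exact: l2_Mz.
  rewrite ipBr ?ip_dl ?ip_sh_sh ?l2_dl //; last exact: l2_dl.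
  by rewrite /th ip_Ms // Lf ip0l //= subr0 mulr0.
have FG0 : ip F G = 0 by rewrite (ipC lG lF) GF0 conjC0.
(* The constant coefficient of (z - q) F is 1. *)
have F0 : sqn F != 0.
  apply/eqP => /(sqn_eq0 lF) F0; have := congr1 (@^~ 0%N) FE.
  by rewrite F0 /Mz /sh /dl /= mulr0 !subr0 => /eqP; rewrite eq_sym oner_eq0.
have Fgt : 0 < sqn F by rewrite lt_def F0 sqn_ge0.
have Gge := sqn_ge0 lG; have FGgt : 0 < sqn F + sqn G by rewrite ltr_pwDl.
(* By orthogonality, |q - p|^2 <f, f> = |F|^2 + |G|^2 and |q - p|^2 <z f, f> = q |F|^2 + p |G|^2;
   the quotient is a convex combination of p and q. *)
have qpf : (fun k => (q - p) * f k) = fun k => F k - G k.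
  by apply/funext => k; rewrite /F /G /Mz; ring.
have qpsf : (fun k => (q - p) * sh f k) = fun k => q * F k - p * G k.
  by apply/funext => k; rewrite /F /G /Mz; ring.
clearbody F G.
have lqF := l2Z q lF; have lpG := l2Z p lG; have lFG := l2B lF lG.
have lqf := l2Z (q - p) lf.
have n1 : nsq (q - p) * sqn f = sqn F + sqn G.
  rewrite -sqnZ // qpf /sqn ipBl // !ipBr // FG0 GF0 !ip_sqn //=.
  by rewrite subr0 sub0r opprK.
have n2 : (nsq (q - p))%:C%C * ip (sh f) f = q * (sqn F)%:C%C + p * (sqn G)%:C%C.
  rewrite -nsq_conj -mulrA -ipZr // -ipZl // qpsf qpf ipBl // !ipBr // !ipZl //.
  by rewrite FG0 GF0 !ip_sqn // !mulr0 subr0 sub0r opprK.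
have f0 : sqn f != 0.
  by apply/eqP => f0; move: FGgt; rewrite -n1 f0 mulr0 ltxx.
(* Thus p and q differ: [Npoly s] has no double root, and distinct indices give distinct vertices of
   the polygon. *)
have qp0 : nsq (q - p) != 0.
  by apply/eqP => qp0; move: FGgt; rewrite -n1 qp0 mul0r ltxx.
set t := sqn G / (sqn F + sqn G); exists t.
  apply/andP; split; first by rewrite divr_ge0 // ltW.
  by rewrite ler_pdivrMr // mul1r lerDr ltW.
have qp0' : (nsq (q - p))%:C%C != 0 :> cplx R by rewrite -nsq_gt0 nsq_real exprn_even_gt0.
apply: (Wseq_normalize kf f0); apply: (mulfI qp0'); rewrite n2 mulrCA -rmorphM n1.
have tS : t * (sqn F + sqn G) = sqn G by rewrite divfK // gt_eqF.
have tS' : (1 - t) * (sqn F + sqn G) = sqn F by rewrite mulrBl mul1r tS addrK.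
have e1 : ((sqn F)%:C%C : cplx R) = (1 - t)%:C%C * (sqn F + sqn G)%:C%C.
  by rewrite -rmorphM /= tS'.
have e2 : ((sqn G)%:C%C : cplx R) = t%:C%C * (sqn F + sqn G)%:C%C.
  by rewrite -rmorphM /= tS.
rewrite e1 e2 /=.
move: ((sqn F + sqn G)%:C%C : cplx R) (t%:C%C : cplx R) ((1 - t)%:C%C : cplx R).
by move=> x y z; ring.
Qed.

Lemma Npoly_factor s : exists c : cplx R, exists2 r : seq (cplx R),
  size r = (size s).+1 & Npoly s = c *: \prod_(z <- r) ('X - z%:P).
Proof.
have [r rE] := closed_field_poly_normal (Npoly s).
exists (lead_coef (Npoly s)), r => //.
have := size_Npoly s; rewrite rE size_scale; first by rewrite size_prod_XsubC => -[].
by rewrite lead_coef_eq0 -size_poly_gt0 size_Npoly.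
Qed.

(* The vertices are the roots of Q - z P. *)
Lemma Wseq_polygon s : in_disk s -> exists2 p : 'I_(size s).+1 -> cplx R,
  (forall i, nsq (p i) = 1) &
  forall i j, i != j ->
    exists2 t : R, 0 <= t <= 1 & Wseq s (t%:C%C * p i + (1 - t)%:C%C * p j).
Proof.
move=> sd; have [c [r rs NE]] := Npoly_factor s.
have {}NE : Npoly s = c *: \prod_(i < (size s).+1) ('X - (r`_i)%:P).
  by rewrite NE (big_nth 0) big_mkord rs.
exists (fun i => r`_i) => [i|i j ij].
  apply: (Npoly_root sd); rewrite NE rootZ; last first.
    by apply/eqP => c0; have := size_Npoly s; rewrite NE c0 scale0r size_poly0.
  by rewrite (bigD1 i) //= rootM root_XsubC eqxx.
apply: (@chord_in_Wseq s r`_i r`_j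
  (c *: \prod_(k < (size s).+1 | (k != i) && (k != j)) ('X - (r`_k)%:P))) => //.
rewrite NE (bigD1 i) //= (bigD1 j) /=; last by rewrite eq_sym.
by rewrite -!scalerAr.
Qed.

End Chords.

(** * Points of the numerical range far from a given point *)

Section FarPoints.
Variable R : realType.
Implicit Types (c p q z : cplx R) (s : seq (cplx R)).

(* The hypothesis bounds from below the cosine of the angle between the images of
   the endpoints under the disk automorphism sending the hyperbolic midpoint of
   0 and c to 0; denominators have been cleared. *)
Lemma chord_far (c x1 y1 x2 y2 t r X Y : R) :
  x1 ^+ 2 + y1 ^+ 2 = 1 -> x2 ^+ 2 + y2 ^+ 2 = 1 -> 0 <= t <= 1 -> r <= 1 ->
  (2 * r - 1) * ((1 - c * x1) * (1 - c * x2)) <=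
    (x1 - c) * (x2 - c) + (1 - c ^+ 2) * (y1 * y2) ->
  X = t * x1 + (1 - t) * x2 -> Y = t * y1 + (1 - t) * y2 ->
  r * ((1 - c * X) ^+ 2 + (c * Y) ^+ 2) <= (X - c) ^+ 2 + Y ^+ 2.
Proof.
move=> u1 u2 /andP[t0 t1] r1 H XE YE.
set D1 := 1 - c * x1; set D2 := 1 - c * x2.
(* [C] is the polar form, at the two endpoints, of |z - c|^2 - r |1 - c z|^2. The two squares agree
   on the unit circle, so the diagonal terms carry the factor 1 - r. *)
set C := (x1 - c) * (x2 - c) + y1 * y2 - r * (D1 * D2 + c ^+ 2 * (y1 * y2)).
set m := `|y1 * y2|.
(* For y1 y2 < 0 this is [H] itself; otherwise it exceeds [H] by 2 (1 - r) c^2 y1 y2. *)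
have key : 0 <= (1 - r) * (D1 * D2 + c ^+ 2 * m) + C.
  have c0 := sqr_ge0 c; rewrite /C /m; move: H; rewrite -/D1 -/D2.
  set d := D1 * D2; set e := (x1 - c) * (x2 - c).
  have [y0|y0] := ger0P (y1 * y2); set y := y1 * y2 in y0 *; set k := c ^+ 2 in c0 * => H.
    have : 0 <= (1 - r) * (k * y) by apply: mulr_ge0; [rewrite subr_ge0|exact: mulr_ge0].
    by move=> h; nra.
  by nra.
(* This bounds the diagonal terms, so that the difference to be estimated is at least 2 t (1 - t)
   times the quantity in [key]. *)
have amgm : 2 * (t * (1 - t)) * (D1 * D2 + c ^+ 2 * m) <=
    t ^+ 2 * (D1 ^+ 2 + (c * y1) ^+ 2) + (1 - t) ^+ 2 * (D2 ^+ 2 + (c * y2) ^+ 2).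
  have eqle (a b : R) : a = b -> a <= b by move=> ->.
  have h1 : 2 * (t * (1 - t)) * (D1 * D2) <= (t * D1) ^+ 2 + ((1 - t) * D2) ^+ 2.
    have := sqr_ge0 (t * D1 - (1 - t) * D2).
    by move=> h; rewrite -subr_ge0; apply: le_trans h _; apply: eqle; ring.
  have h2 : 2 * (t * (1 - t)) * (c ^+ 2 * m) <= (t * (c * y1)) ^+ 2 + ((1 - t) * (c * y2)) ^+ 2.
    rewrite /m; have [y0|y0] := ger0P (y1 * y2).
      have := sqr_ge0 (t * (c * y1) - (1 - t) * (c * y2)).
      by move=> h; rewrite -subr_ge0; apply: le_trans h _; apply: eqle; ring.
    have := sqr_ge0 (t * (c * y1) + (1 - t) * (c * y2)).
    by move=> h; rewrite -subr_ge0; apply: le_trans h _; apply: eqle; ring.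
  by rewrite mulrDr; apply: le_trans (lerD h1 h2) _; apply: eqle; ring.
have e1 : (x1 - c) ^+ 2 + y1 ^+ 2 = D1 ^+ 2 + (c * y1) ^+ 2.
  have -> : (x1 - c) ^+ 2 + y1 ^+ 2 = (x1 ^+ 2 + y1 ^+ 2) - 2 * c * x1 + c ^+ 2 by ring.
  have -> : D1 ^+ 2 + (c * y1) ^+ 2 = 1 - 2 * c * x1 + c ^+ 2 * (x1 ^+ 2 + y1 ^+ 2) by rewrite /D1; ring.
  by rewrite u1 mulr1.
have e2 : (x2 - c) ^+ 2 + y2 ^+ 2 = D2 ^+ 2 + (c * y2) ^+ 2.
  have -> : (x2 - c) ^+ 2 + y2 ^+ 2 = (x2 ^+ 2 + y2 ^+ 2) - 2 * c * x2 + c ^+ 2 by ring.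
  have -> : D2 ^+ 2 + (c * y2) ^+ 2 = 1 - 2 * c * x2 + c ^+ 2 * (x2 ^+ 2 + y2 ^+ 2) by rewrite /D2; ring.
  by rewrite u2 mulr1.
have E : (X - c) ^+ 2 + Y ^+ 2 - r * ((1 - c * X) ^+ 2 + (c * Y) ^+ 2) =
    (1 - r) * (t ^+ 2 * (D1 ^+ 2 + (c * y1) ^+ 2) + (1 - t) ^+ 2 * (D2 ^+ 2 + (c * y2) ^+ 2))
    + 2 * (t * (1 - t)) * C.
  have -> : (X - c) ^+ 2 + Y ^+ 2 = t ^+ 2 * ((x1 - c) ^+ 2 + y1 ^+ 2) +
      (1 - t) ^+ 2 * ((x2 - c) ^+ 2 + y2 ^+ 2) +
      2 * (t * (1 - t)) * ((x1 - c) * (x2 - c) + y1 * y2) by rewrite XE YE; ring.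
  rewrite e1 e2 /C XE YE /D1 /D2; ring.
rewrite -subr_ge0 E.
have t01 : 0 <= 2 * (t * (1 - t)) by rewrite !mulr_ge0 // subr_ge0.
have r0 : 0 <= 1 - r by rewrite subr_ge0.
have h1 := ler_wpM2l r0 amgm.
have h2 := mulr_ge0 t01 key.
apply: le_trans h2 _; rewrite mulrDr lerD2r.
by apply: le_trans h1; rewrite le_eqVlt; apply/orP; left; apply/eqP; ring.
Qed.

Lemma pigeonhole m n (f : 'I_m -> 'I_n) : (n < m)%N ->
  exists i j, i != j /\ f i = f j.
Proof.
move=> nm; have [inj|] := boolP (injectiveb f).
  by have := leq_card f (injectiveP _ inj); rewrite !card_ord leqNgt nm.
by move=> /injectivePn[i [j ij fij]]; exists i, j.
Qed.

Definition dot (u v : R * R) : R := u.1 * v.1 + u.2 * v.2.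
Definition cross (u v : R * R) : R := u.1 * v.2 - u.2 * v.1.

Lemma dot_frame u v w : dot u u = 1 ->
  dot v w = dot u v * dot u w + cross u v * cross u w.
Proof.
move=> u1; have -> : dot u v * dot u w + cross u v * cross u w = dot u u * dot v w.
  by rewrite /dot /cross; ring.
by rewrite u1 mul1r.
Qed.

(** If the other vectors, at least three, all make obtuse angles with the first, two of them lie on
    the same side of its line; in its frame both terms of their inner product are nonnegative. *)
Lemma four_unit_vectors m (V : 'I_m.+1 -> R * R) : (2 < m)%N ->
  (forall i, dot (V i) (V i) = 1) -> exists i j, i != j /\ 0 <= dot (V i) (V j).
Proof.
move=> m2 V1; apply: contrapT => /forallNP no.
have neg i j : i != j -> dot (V i) (V j) < 0.
  by move=> ij; rewrite ltNge; apply/negP => h; have /forallNP /(_ j) := no i; apply.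
pose lab (i : 'I_m) : 'I_2 := if 0 <= cross (V ord0) (V (lift ord0 i)) then 0 else 1.
have [i [j [ij e]]] := pigeonhole lab m2.
have ni := neg _ _ (neq_lift ord0 i); have nj := neg _ _ (neq_lift ord0 j).
have := neg (lift ord0 i) (lift ord0 j); rewrite (inj_eq lift_inj) => /(_ ij).
rewrite (dot_frame _ _ (V1 ord0)) ltNge => /negP; apply.
rewrite addr_ge0 //; first by rewrite mulr_le0 // ltW.
move: e; rewrite /lab; case: lerP => h1; case: lerP => h2 // _.
  by rewrite mulr_ge0.
by rewrite mulr_le0 // ltW.
Qed.

Lemma unit_sum_ge1 (u v : R) : 0 <= u -> 0 <= v -> 0 <= (u + v) ^+ 2 - 1 -> 1 <= u + v.
Proof.
move=> u0 v0; rewrite subr_ge0 -{1}(expr1n _ 2) ler_sqr ?nnegrE ?addr_ge0 //.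
Qed.

(* A sector of angle arccos(3/5), with right side spanned by g. *)
Lemma sector_dot g v w : dot g g = 1 -> dot v v = 1 -> dot w w = 1 ->
  0 <= cross g v -> 3 * cross g v <= 4 * dot g v ->
  0 <= cross g w -> 3 * cross g w <= 4 * dot g w -> 3 / 5 <= dot v w.
Proof.
move=> g1 v1 w1; rewrite (dot_frame v w g1).
have := dot_frame v v g1; have := dot_frame w w g1; rewrite v1 w1.
move: (cross g v) (cross g w) (dot g v) (dot g w) => q q' p p' {v1 w1} w1 v1 q0 pq q'0 pq'.
have p0 : 0 <= p by lra.
have p'0 : 0 <= p' by lra.
(* In the frame of [g], v is p - 3q/4 times one side of the sector plus 5q/4 times the other side,
   (3/5, 4/5). The coefficients are nonnegative with sum at least 1, and w has inner product at
   least 3/5 with either side. *)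
have l1 : 1 <= p - 3 / 4 * q + 5 / 4 * q.
  have : 0 <= (p - 3 / 4 * q) * q by rewrite mulr_ge0 //; lra.
  move=> h; apply: unit_sum_ge1; [lra|lra|nra].
have l2 : 1 <= p' + q' by apply: unit_sum_ge1 => //; have := mulr_ge0 p'0 q'0; nra.
have p'35 : 3 / 5 <= p'.
  have h : 0 <= (4 * p' - 3 * q') * (4 * p' + 3 * q') by rewrite mulr_ge0 //; lra.
  by rewrite -ler_sqr ?nnegrE //; nra.
have h1 : 0 <= (p - 3 / 4 * q) * (p' - 3 / 5) by rewrite mulr_ge0 //; lra.
have h2 : 0 <= q * (3 * p' + 4 * q' - 3) by rewrite mulr_ge0 //; lra.
nra.
Qed.

(* The powers g^1, ..., g^5 of g = (3 + 4i)/5 are the right sides of five sectors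
   covering the part of the unit circle with abscissa < 3/5. *)
Definition sector_side (k : 'I_5) : R * R :=
  nth (0, 0) [:: (3 / 5, 4 / 5); (- (7 / 25), 24 / 25); (- (117 / 125), 44 / 125);
    (- (527 / 625), - (336 / 625)); (- (237 / 3125), - (3116 / 3125))] k.

Lemma sector_side_unit k : dot (sector_side k) (sector_side k) = 1.
Proof.
by case: k => -[|[|[|[|[|//]]]]] k5; rewrite /sector_side /dot /=; field.
Qed.

Lemma sector_cover v : v.1 < 3 / 5 -> dot v v = 1 -> exists k,
  0 <= cross (sector_side k) v /\
  3 * cross (sector_side k) v <= 4 * dot (sector_side k) v.
Proof.
case: v => a b; rewrite /dot /= => a35 ab1.
have [b0|b0] := lerP 0 b.
  have c1 : 0 <= 3 * b - 4 * a.
    have [a0|a0] := lerP a 0; first lra.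
    have : (4 / 5) ^+ 2 <= b ^+ 2 by nra.
    by rewrite ler_sqr ?nnegrE //; lra.
  clear ab1; have [c2|c2] := lerP (7 * b + 24 * a) 0; last first.
    by exists (@Ordinal 5 0 isT); rewrite /sector_side /cross /dot /=; split; lra.
  have [c3|c3] := lerP (117 * b + 44 * a) 0; last first.
    by exists (@Ordinal 5 1 isT); rewrite /sector_side /cross /dot /=; split; lra.
  by exists (@Ordinal 5 2 isT); rewrite /sector_side /cross /dot /=; split; lra.
(* The sixth power of g is (11753 - 10296 i) / 15625, of abscissa above 3/5, so v comes before the
   far side of the last sector. *)
have c6 : 11753 * b + 10296 * a <= 0.
  have [a0|a0] := lerP a 0; first lra.
  have hb : (4 / 5) ^+ 2 <= (- b) ^+ 2 by nra.
  have : 4 / 5 <= - b by rewrite -ler_sqr ?nnegrE ?oppr_ge0 ?(ltW b0) //; lra.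
  clear ab1 hb; lra.
clear ab1; have [c5|c5] := lerP 0 (3116 * a - 237 * b).
  clear b0 a35; by exists (@Ordinal 5 4 isT); rewrite /sector_side /cross /dot /=; split; lra.
have [c4|c4] := lerP 0 (336 * a - 527 * b).
  clear b0 a35 c6; by exists (@Ordinal 5 3 isT); rewrite /sector_side /cross /dot /=; split; lra.
clear a35 c6 c5; by exists (@Ordinal 5 2 isT); rewrite /sector_side /cross /dot /=; split; lra.
Qed.

(** If the others all stay away from the first vector, then at least six vectors, read in its frame,
    share five sectors of angle arccos(3/5). *)
Lemma seven_unit_vectors m (V : 'I_m.+1 -> R * R) : (5 < m)%N ->
  (forall i, dot (V i) (V i) = 1) -> exists i j, i != j /\ 3 / 5 <= dot (V i) (V j).
Proof.
move=> m5 V1; apply: contrapT => /forallNP no.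
have neg i j : i != j -> dot (V i) (V j) < 3 / 5.
  by move=> ij; rewrite ltNge; apply/negP => h; have /forallNP /(_ j) := no i; apply.
pose U (i : 'I_m) : R * R :=
  (dot (V ord0) (V (lift ord0 i)), cross (V ord0) (V (lift ord0 i))).
have dotU i j : dot (V (lift ord0 i)) (V (lift ord0 j)) = dot (U i) (U j).
  exact: dot_frame.
have U1 i : dot (U i) (U i) = 1 by rewrite -dotU.
have /choice[lab sector] i := sector_cover (neg _ _ (neq_lift ord0 i) : (U i).1 < _) (U1 i).
have [i [j [ij e]]] := pigeonhole lab m5.
have := neg (lift ord0 i) (lift ord0 j); rewrite (inj_eq lift_inj) => /(_ ij).
rewrite dotU ltNge => /negP; apply.
have [i1 i2] := sector i; have [j1 j2] := sector j.
by rewrite -e in j1 j2; apply: (sector_dot (sector_side_unit (lab i))).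
Qed.

(** The pigeonhole hypothesis concerns all families since it is applied to images of the vertices
    that depend on c. [chord_far] then keeps a whole chord outside the disk of center c and squared
    radius r, and the numerical range has a point on it. *)
Lemma W_far s c (r : R) : in_disk s -> nsq c < 1 -> r <= 1 ->
  (forall V : 'I_(size s).+1 -> R * R, (forall i, dot (V i) (V i) = 1) ->
     exists i j, i != j /\ 2 * r - 1 <= dot (V i) (V j)) ->
  exists2 z, Wseq s z & r * nsq (1 - c^* * z) <= nsq (z - c).
Proof.
move=> sd c1 r1 pig; have [P P1 Pw] := Wseq_polygon sd.
(* Rotate so that c becomes the nonnegative number k. *)
have [k [u [k0 u1 cE]]] : exists k : R, exists u : cplx R,
    [/\ 0 <= k, nsq u = 1 & c = k%:C%C * u].
  have [->|c0] := eqVneq c 0.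
    by exists 0, 1; split; rewrite ?nsq1 ?mul0r.
  have s0 : Num.sqrt (nsq c) != 0 by rewrite sqrtr_eq0 -ltNge nsq_gt0.
  exists (Num.sqrt (nsq c)), ((Num.sqrt (nsq c))^-1%:C%C * c); split.
  - exact: sqrtr_ge0.
  - rewrite nsqM nsq_real exprVn sqr_sqrtr ?nsq_ge0 // mulVf //.
    by rewrite nsq_eq0.
  - by rewrite mulrA -rmorphM /= mulfV // mul1r.
have k1 : k ^+ 2 < 1 by move: c1; rewrite cE nsqM u1 mulr1 nsq_real.
have k1' : k < 1 by rewrite -(expr1n R 2) ltr_sqr ?nnegrE in k1.
have uu : u^* * u = 1 by rewrite mulrC nsq_conj u1.
pose x i := Re (u^* * P i); pose y i := Im (u^* * P i).
have xy1 i : x i ^+ 2 + y i ^+ 2 = 1.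
  by have : nsq (u^* * P i) = 1 by rewrite nsqM nsqJ u1 P1 mulr1.
have D i : 0 < 1 - k * x i.
  have x1 : x i <= 1 by have := xy1 i; have := sqr_ge0 (y i); nra.
  rewrite subr_gt0; apply: le_lt_trans k1'.
  by rewrite -[X in _ <= X]mulr1 ler_wpM2l.
pose e := Num.sqrt (1 - k ^+ 2).
have e2 : e ^+ 2 = 1 - k ^+ 2 by rewrite sqr_sqrtr // subr_ge0 ltW.
(* For k = 2 m / (1 + m^2) this is the image of the i-th rotated vertex under u |-> (u - m) / (1 - m
   u), and [e] is (1 - m^2) / (1 + m^2). *)
pose V i : R * R := ((x i - k) / (1 - k * x i), e * y i / (1 - k * x i)).
have V1 i : dot (V i) (V i) = 1.
  have n0 : 1 - k * x i != 0 by rewrite gt_eqF.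
  rewrite /dot /V /=; apply: (mulIf (expf_neq0 2 n0)); rewrite mul1r.
  have -> : ((x i - k) / (1 - k * x i) * ((x i - k) / (1 - k * x i)) +
    e * y i / (1 - k * x i) * (e * y i / (1 - k * x i))) * (1 - k * x i) ^+ 2 =
    (x i - k) ^+ 2 + e ^+ 2 * y i ^+ 2 by field.
  have -> : y i ^+ 2 = 1 - x i ^+ 2 by rewrite -(xy1 i) addrC addKr.
  by rewrite e2; ring.
have [i [j [ij dij]]] := pig V V1.
have [t t01 Wt] := Pw _ _ ij.
pose z := t%:C%C * P i + (1 - t)%:C%C * P j; exists z => //.
have H : (2 * r - 1) * ((1 - k * x i) * (1 - k * x j)) <=
    (x i - k) * (x j - k) + (1 - k ^+ 2) * (y i * y j).
  have DD : 0 < (1 - k * x i) * (1 - k * x j) by rewrite mulr_gt0.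
  have := ler_wpM2r (ltW DD) dij.
  have [n1 n2] : 1 - k * x i != 0 /\ 1 - k * x j != 0 by rewrite !gt_eqF.
  have -> : dot (V i) (V j) * ((1 - k * x i) * (1 - k * x j)) =
      (x i - k) * (x j - k) + e ^+ 2 * (y i * y j).
    by rewrite /dot /V /=; field; rewrite n1 n2.
  by rewrite e2.
have := chord_far (xy1 i) (xy1 j) t01 r1 H erefl erefl.
set X := t * x i + _; set Y := t * y i + _.
have zE : u^* * z = Complex X Y.
  have -> : u^* * z = t%:C%C * (u^* * P i) + (1 - t)%:C%C * (u^* * P j).
    by rewrite /z; ring.
  rewrite /X /Y /x /y.
  by case: (u^* * P i) (u^* * P j) => a1 b1 [a2 b2]; apply/eqP; rewrite eq_complex /=; apply/andP; split; apply/eqP; ring.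
have e3 : nsq (z - c) = (X - k) ^+ 2 + Y ^+ 2.
  have -> : nsq (z - c) = nsq (u^* * (z - c)) by rewrite nsqM nsqJ u1 mul1r.
  rewrite mulrBr zE cE mulrCA uu mulr1 /nsq /=; congr (_ + _); ring.
have e4 : nsq (1 - c^* * z) = (1 - k * X) ^+ 2 + (k * Y) ^+ 2.
  rewrite cE rmorphM /= -mulrA zE /nsq /=; ring.
by rewrite e3 e4.
Qed.

Lemma W_far_half s c : in_disk s -> (2 < size s)%N -> nsq c < 1 ->
  exists2 z, Wseq s z & 1 / 2 * nsq (1 - c^* * z) <= nsq (z - c).
Proof.
move=> sd s2 c1; apply: W_far => //; first lra.
move=> V /(four_unit_vectors s2)[i [j [ij h]]]; exists i, j; split=> //; lra.
Qed.

Lemma W_far_four_fifths s c : in_disk s -> (5 < size s)%N -> nsq c < 1 ->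
  exists2 z, Wseq s z & 4 / 5 * nsq (1 - c^* * z) <= nsq (z - c).
Proof.
move=> sd s5 c1; apply: W_far => //; first lra.
move=> V /(seven_unit_vectors s5)[i [j [ij h]]]; exists i, j; split=> //; lra.
Qed.

End FarPoints.

(** * Pseudohyperbolic geometry of Blaschke products *)

Section Pseudohyperbolic.
Variable R : realType.
Implicit Types (a b c z w : cplx R) (s : seq (cplx R)).

(** The squared pseudohyperbolic distance; [phi c] is the disk automorphism that sends c to 0, with
    inverse [phi (- c)]. *)
Definition rho2 a z : R := nsq (z - a) / nsq (1 - a^* * z).
Definition phi c z : cplx R := (z - c) / (1 - c^* * z).

Lemma nsq_bl (B : finBlaschke R) z :
  nsq (B z) = \prod_(a <- bl_zeros B) rho2 a z.
Proof.
rewrite /bl_fun nsqM (norm1_nsq (bl_constP B)) mul1r nsq_prod.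
by apply: eq_bigr => a _; rewrite nsqM nsqV.
Qed.

Lemma rho2_ge0 a z : 0 <= rho2 a z.
Proof. by rewrite divr_ge0 ?nsq_ge0. Qed.

Lemma rho2_den_gt0 a z : nsq a < 1 -> nsq z <= 1 -> 0 < nsq (1 - a^* * z).
Proof. by move=> a1 z1; rewrite nsq_gt0 blaschke_den_neq0. Qed.

Lemma rho2_0 z : rho2 0 z = nsq z.
Proof. by rewrite /rho2 conjC0 mul0r !subr0 nsq1 divr1. Qed.

Lemma nsq_phi c z : nsq (phi c z) = rho2 c z.
Proof. by rewrite /phi nsqM nsqV. Qed.

Lemma rho2_lt1 c z : nsq c < 1 -> nsq z < 1 -> rho2 c z < 1.
Proof.
move=> c1 z1; rewrite ltr_pdivrMr ?rho2_den_gt0 ?(ltW z1) // mul1r -subr_gt0.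
by rewrite pseudo_identity mulr_gt0 // subr_gt0.
Qed.

Lemma nsq_phi_lt1 c z : nsq c < 1 -> nsq z < 1 -> nsq (phi c z) < 1.
Proof. by move=> c1 z1; rewrite nsq_phi rho2_lt1. Qed.

Lemma phi_den c z : nsq c < 1 -> nsq z < 1 ->
  1 - c^* * z != 0 /\ 1 - c * z^* != 0.
Proof.
move=> c1 z1; split; first by rewrite blaschke_den_neq0 // ltW.
by rewrite -[c]conjCK blaschke_den_neq0 ?nsqJ // ltW.
Qed.

Lemma one_sub_nsq c : nsq c < 1 -> 1 - c * c^* != 0.
Proof.
move=> c1; rewrite nsq_conj -(rmorph1 (real_complex R)) -rmorphB.
by rewrite -nsq_gt0 nsq_real exprn_even_gt0 //= subr_eq0 gt_eqF.
Qed.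

Lemma phiK c w : nsq c < 1 -> nsq w < 1 -> phi c (phi (- c) w) = w.
Proof.
move=> c1 w1; have cN : nsq (- c) < 1 by rewrite nsqN.
have [d1 _] := phi_den cN w1; rewrite rmorphN mulNr opprK in d1.
have n1 := one_sub_nsq c1.
rewrite /phi rmorphN mulNr !opprK /=.
have -> : (w + c) / (1 + c^* * w) - c = w * (1 - c * c^*) / (1 + c^* * w) by field.
have -> : 1 - c^* * ((w + c) / (1 + c^* * w)) = (1 - c * c^*) / (1 + c^* * w) by field.
by field; rewrite d1 n1.
Qed.

Lemma phiKV c w : nsq c < 1 -> nsq w < 1 -> phi (- c) (phi c w) = w.
Proof. by move=> c1 w1; have := @phiK (- c) w; rewrite nsqN opprK; apply. Qed.

Lemma rho2_phi c a z : nsq c < 1 -> nsq a < 1 -> nsq z < 1 ->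
  rho2 (phi c a) (phi c z) = rho2 a z.
Proof.
move=> c1 a1 z1; have [d1 d1'] := phi_den c1 a1; have [d2 _] := phi_den c1 z1.
have n1 := one_sub_nsq c1.
have e1 : phi c z - phi c a = (z - a) * ((1 - c * c^*) / ((1 - c^* * z) * (1 - c^* * a))).
  by rewrite /phi; field; rewrite d1 d2.
have e2 : 1 - (phi c a)^* * phi c z =
    (1 - a^* * z) * ((1 - c * c^*) / ((1 - c^* * z) * (1 - c * a^*))).
  rewrite /phi rmorphM fmorphV !rmorphB rmorph1 rmorphM /= conjCK.
  by field; rewrite d1' d2.
have e3 : nsq (1 - c^* * a) = nsq (1 - c * a^*).
  by rewrite -nsqJ rmorphB rmorph1 rmorphM /= conjCK.
rewrite /rho2 e1 e2 !nsqM !nsqV !nsqM e3 -mulf_div divff ?mulr1 //.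
by rewrite mulf_neq0 ?invr_eq0 ?mulf_neq0 // nsq_eq0.
Qed.

Lemma nsq_bl_ge1 (B : finBlaschke R) z :
  (forall a, a \in bl_zeros B -> 1 - a^* * z != 0) -> 1 <= nsq z -> 1 <= nsq (B z).
Proof.
move=> d z1; rewrite nsq_bl big_seq; elim/big_ind : _ => // [x y x1 y1|a aB].
  by rewrite -[1]mulr1 ler_pM.
have a1 := zeros_in_disk aB.
rewrite /rho2 ler_pdivlMr ?nsq_gt0 ?d // mul1r -subr_le0 pseudo_identity.
by rewrite mulr_ge0_le0 // ?subr_le0 // subr_ge0 ltW.
Qed.

(** For given moduli the distance is least on a common ray: with denominators cleared, the
    difference is 2 (r x - Re(conj(a) z)) (1 - r^2) (1 - x^2). *)
Lemma rho2_ge_moduli a z (x r : R) : nsq a < 1 -> nsq z <= 1 ->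
  0 <= x -> x ^+ 2 = nsq a -> 0 <= r -> r ^+ 2 = nsq z ->
  ((x - r) / (1 - r * x)) ^+ 2 <= rho2 a z.
Proof.
move=> a1 z1 x0 xa r0 rz.
have x1 : x < 1 by rewrite -ltr_sqr ?nnegrE // expr1n xa.
have r1 : r <= 1 by rewrite -ler_sqr ?nnegrE // expr1n rz.
have d : 0 < 1 - r * x by rewrite subr_gt0; nra.
have m : Re (a^* * z) <= r * x.
  apply: (@le_trans _ _ `|Re (a^* * z)|); first exact: ler_norm.
  rewrite -ler_sqr ?nnegrE ?mulr_ge0 // real_normK ?num_real //.
  rewrite exprMn xa rz mulrC -(nsqJ a) -nsqM /nsq lerDl; exact: sqr_ge0.
have e1 : nsq (z - a) = r ^+ 2 + x ^+ 2 - 2 * Re (a^* * z).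
  by rewrite xa rz; case: (a) (z) => p q [t u]; rewrite conjE /nsq /=; ring.
have e2 : nsq (1 - a^* * z) = 1 + r ^+ 2 * x ^+ 2 - 2 * Re (a^* * z).
  by rewrite xa rz; case: (a) (z) => p q [t u]; rewrite conjE /nsq /=; ring.
have dz := rho2_den_gt0 a1 z1.
rewrite /rho2 ler_pdivlMr // expr_div_n mulrAC ler_pdivrMr ?exprn_gt0 // e1 e2.
move: m; set y := Re _ => m; rewrite -subr_ge0.
have -> : (r ^+ 2 + x ^+ 2 - 2 * y) * (1 - r * x) ^+ 2 -
  (x - r) ^+ 2 * (1 + r ^+ 2 * x ^+ 2 - 2 * y) =
  2 * (r * x - y) * ((1 - r ^+ 2) * (1 - x ^+ 2)) by ring.
rewrite !mulr_ge0 ?subr_ge0 // ?xa ?rz //; exact: ltW.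
Qed.

(** Serves to choose a circle that misses finitely many moduli. The induction moves the left end
    past each listed value below y. *)
Lemma exists_avoid (s : seq R) (x y : R) : x < y ->
  exists2 t, x < t < y & t \notin s.
Proof.
move=> xy; suff [x' /andP[xx' x'y] h] : exists2 x', x <= x' < y &
    forall t, x' < t < y -> t \notin s.
  have t := midf_lt x'y; exists ((x' + y) / 2).
    by rewrite !midf_lt ?(le_lt_trans xx') //= midf_lt.
  by apply: h; rewrite !midf_lt.
elim: s => [|a s [x' /andP[xx' x'y] h]]; first by exists x => //; rewrite lexx.
have [ay|ya] := ltP a y; last first.
  exists x'; first by rewrite xx' x'y.
  move=> t tI; rewrite inE negb_or h // andbT lt_eqF //.
  by apply: lt_le_trans ya; case/andP: tI.
exists (Num.max x' a); first by rewrite le_max xx' /= gt_max x'y.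
move=> t /andP[]; rewrite gt_max => /andP[t1 t2] ty.
by rewrite inE negb_or gt_eqF //= h // t1.
Qed.

Lemma bernoulli_ge (x : R) n : 0 <= x <= 1 -> 1 - n%:R * x <= (1 - x) ^+ n.
Proof.
move=> /andP[x0 x1]; elim: n => [|n IH]; first by rewrite mul0r subr0.
have x1' : 0 <= 1 - x by rewrite subr_ge0.
rewrite exprS; apply: le_trans (ler_wpM2l x1' IH).
rewrite -subr_ge0 -natr1.
have -> : (1 - x) * (1 - n%:R * x) - (1 - (n%:R + 1) * x) = n%:R * x ^+ 2 by ring.
by rewrite mulr_ge0 ?sqr_ge0.
Qed.

Lemma prod_const_seq (A : pzRingType) (I : Type) (r : seq I) (x : A) :
  \prod_(i <- r) x = x ^+ size r.
Proof. by elim: r => [|i r IH]; rewrite ?big_nil ?big_cons //= IH exprS. Qed.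

(** The list consists of the roots of z^N - t^N. The product of the |a - z| is the modulus of this
    polynomial at a; that of the |1 - conj(a) z| comes from its value at 1 / conj(a), the case a = 0
    being separate. *)
Lemma root_circle (t : R) (N : nat) : 0 < t -> (0 < N)%N ->
  exists2 r : seq (cplx R), size r = N /\ (forall z, z \in r -> nsq z = t ^+ 2) &
  forall a, \prod_(z <- r) rho2 a z =
    nsq (a ^+ N - t%:C%C ^+ N) / nsq (1 - (a^* * t%:C%C) ^+ N).
Proof.
move=> t0 N0; pose p : {poly cplx R} := 'X^N - (t%:C%C ^+ N)%:P.
have pm : p \is monic by exact: monicXnsubC.
have [r rE] := closed_field_poly_normal p.
rewrite (monicP pm) scale1r in rE.
have pr a : \prod_(z <- r) (a - z) = a ^+ N - t%:C%C ^+ N.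
  have : p.[a] = a ^+ N - t%:C%C ^+ N by rewrite !hornerE.
  rewrite rE horner_prod => <-; apply: eq_bigr => z _.
  by rewrite !hornerE.
exists r.
  split.
    have := congr1 (fun q : {poly _} => size q) rE.
    by rewrite size_prod_XsubC /p size_XnsubC // => -[].
  move=> z zr; have : root p z by rewrite rE root_prod_XsubC.
  rewrite /root !hornerE subr_eq0 => /eqP /(congr1 (@nsq R)).
  rewrite !nsqX nsq_real => /eqP; rewrite eqrXn2 ?nsq_ge0 ?sqr_ge0 //.
  by move=> /eqP.
move=> a; rewrite /rho2 big_split /= -!nsq_prod.
have -> : nsq (\prod_(z <- r) (z - a)) = nsq (\prod_(z <- r) (a - z)).
  by rewrite !nsq_prod; apply: eq_bigr => z _; rewrite -nsqN opprB.
rewrite pr prodfV -nsq_prod; congr (_ / nsq _).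
have [->|a0] := eqVneq a 0.
  rewrite conjC0 mul0r expr0n gtn_eqF //= subr0 big1 // => z _.
  by rewrite mul0r subr0.
have a0' : a^* != 0 by rewrite conjC_eq0.
have sz : size r = N.
  have := congr1 (fun q : {poly _} => size q) rE.
  by rewrite size_prod_XsubC /p size_XnsubC // => -[].
transitivity (a^* ^+ N * \prod_(z <- r) ((a^*)^-1 - z)).
  rewrite -sz -prod_const_seq -big_split /=; apply: eq_bigr => z _.
  by rewrite mulrBr mulfV.
by rewrite pr mulrBr -exprMn mulfV // expr1n exprMn.
Qed.

Lemma nsq_sub_ge (u v : cplx R) (x y : R) : 0 <= x -> 0 <= y ->
  nsq u = x ^+ 2 -> nsq v = y ^+ 2 -> (x - y) ^+ 2 <= nsq (u - v).
Proof.
move=> x0 y0 ux vy.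
have e : nsq (u - v) = x ^+ 2 + y ^+ 2 - 2 * Re (u * v^*).
  by rewrite -ux -vy; case: (u) (v) => p q [s t]; rewrite conjE /nsq /=; ring.
have m : Re (u * v^*) <= x * y.
  apply: (@le_trans _ _ `|Re (u * v^*)|); first exact: ler_norm.
  rewrite -ler_sqr ?nnegrE ?mulr_ge0 // real_normK ?num_real //.
  rewrite exprMn -ux -vy -(nsqJ v) -nsqM /nsq lerDl; exact: sqr_ge0.
rewrite e; lra.
Qed.

(** The constant is uniform in N: if m < M are the numbers |a| and t in order, then |a^N - t^N| >=
    (1 - m/M) M^N >= (1 - m/M) t^N, while the denominator is at most 4. *)
Lemma circle_factor_ge (t : R) a : 0 < t -> nsq a < 1 -> t < 1 -> nsq a != t ^+ 2 ->
  exists2 K : R, 0 < K & forall N, (0 < N)%N -> K * (t ^+ 2) ^+ N <=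
    nsq (a ^+ N - t%:C%C ^+ N) / nsq (1 - (a^* * t%:C%C) ^+ N).
Proof.
move=> t0 a1 t1 at2; set x := Num.sqrt (nsq a).
have x0 : 0 <= x by exact: sqrtr_ge0.
have xa : nsq a = x ^+ 2 by rewrite sqr_sqrtr ?nsq_ge0.
have x1 : x < 1 by rewrite -ltr_sqr ?nnegrE // expr1n -xa.
have den N : (0 < N)%N -> 0 < nsq (1 - (a^* * t%:C%C) ^+ N) <= 4.
  move=> N0; set y := _ ^+ N.
  have y1 : nsq y < 1.
    have at1 : nsq a * t ^+ 2 < 1.
      by apply: mulr_ilt1; rewrite ?nsq_ge0 ?sqr_ge0 // exprn_ilt1 // ltW.
    rewrite /y nsqX nsqM nsqJ nsq_real exprn_ilt1 // -?lt0n //.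
    by rewrite mulr_ge0 ?nsq_ge0 ?sqr_ge0.
  apply/andP; split.
    rewrite nsq_gt0; apply/eqP => /eqP; rewrite subr_eq0 => /eqP h.
    by move: y1; rewrite -h nsq1 ltxx.
  apply: le_trans (nsqD_le _ _) _; rewrite nsqN nsq1; lra.
have bound (m M : R) N : (0 < N)%N -> 0 <= m -> m < M -> t <= M ->
    (1 - m / M) ^+ 2 * (t ^+ 2) ^+ N <= (M ^+ N - m ^+ N) ^+ 2.
  move=> N0 m0 mM tM; have M0 : 0 < M by apply: le_lt_trans mM.
  have mM1 : m / M < 1 by rewrite ltr_pdivrMr ?mul1r.
  have mM0 : 0 <= m / M by rewrite divr_ge0 // ltW.
  rewrite -exprM mulnC exprM -exprMn ler_sqr ?nnegrE; last 2 first.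
  - by rewrite mulr_ge0 ?exprn_ge0 ?subr_ge0 // ltW.
  - by rewrite subr_ge0 lerXn2r ?nnegrE ?(ltW M0) // ltW.
  have h : (m / M) ^+ N <= m / M.
    by case: (N) N0 => // k _; rewrite exprS ler_piMr // exprn_ile1 // ltW.
  have -> : M ^+ N - m ^+ N = (1 - (m / M) ^+ N) * M ^+ N.
    by rewrite mulrBl mul1r -exprMn divfK // gt_eqF.
  apply: ler_pM; rewrite ?subr_ge0 ?exprn_ge0 ?(ltW t0) ?(ltW mM1) ?lerB //.
  by rewrite lerXn2r ?nnegrE ?(ltW t0) ?(ltW M0).
have nx N : nsq (a ^+ N) = (x ^+ N) ^+ 2 by rewrite nsqX xa -!exprM mulnC.
have nt N : nsq (t%:C%C ^+ N : cplx R) = (t ^+ N) ^+ 2.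
  by rewrite nsqX nsq_real -!exprM mulnC.
have base N : (x ^+ N - t ^+ N) ^+ 2 <= nsq (a ^+ N - t%:C%C ^+ N).
  by apply: nsq_sub_ge; rewrite ?exprn_ge0 // ltW.
have fin (K : R) : 0 < K -> (forall N, (0 < N)%N -> K * (t ^+ 2) ^+ N <= (x ^+ N - t ^+ N) ^+ 2) ->
    exists2 K : R, 0 < K & forall N, (0 < N)%N -> K * (t ^+ 2) ^+ N <=
    nsq (a ^+ N - t%:C%C ^+ N) / nsq (1 - (a^* * t%:C%C) ^+ N).
  move=> K0 h; exists (K / 4); first by rewrite divr_gt0.
  move=> N N0; have /andP[d0 d4] := den N N0; rewrite (ler_pdivlMr _ _ d0).
  apply: le_trans (base N); apply: le_trans (h N N0).
  rewrite -!mulrA; apply: ler_wpM2l; first exact: ltW.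
  have T0 : 0 <= (t ^+ 2) ^+ N by rewrite !exprn_ge0 // ltW.
  by have := ler_wpM2l T0 d4; lra.
have [xt|tx|xt] := ltgtP x t.
- apply: (fin ((1 - x / t) ^+ 2)) => [|N N0].
    by rewrite exprn_gt0 // subr_gt0 ltr_pdivrMr ?mul1r.
  by rewrite -[leRHS]sqrrN opprB; exact: bound.
- apply: (fin ((1 - t / x) ^+ 2)) => [|N N0].
    by rewrite exprn_gt0 // subr_gt0 ltr_pdivrMr ?mul1r // (lt_trans t0).
  by apply: bound => //; exact: ltW.
- by move: at2; rewrite xa xt eqxx.
Qed.

Lemma circle_prod_ge (t : R) s : 0 < t -> t < 1 -> in_disk s ->
  (forall a, a \in s -> nsq a != t ^+ 2) ->
  exists2 K : R, 0 < K & forall N, (0 < N)%N -> K * (t ^+ 2) ^+ (size s * N) <=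
    \prod_(a <- s) (nsq (a ^+ N - t%:C%C ^+ N) / nsq (1 - (a^* * t%:C%C) ^+ N)).
Proof.
move=> t0 t1; elim: s => [_ _|a s IH /in_disk_cons[a1 s1] h].
  by exists 1 => // N _; rewrite big_nil mul0n expr0 mulr1.
have [|K K0 hK] := IH s1; first by move=> b bs; apply: h; rewrite inE bs orbT.
have [|L L0 hL] := circle_factor_ge t0 a1 t1; first by apply: h; rewrite mem_head.
exists (L * K) => [|N N0]; first by rewrite mulr_gt0.
rewrite big_cons /= mulSn exprD mulrACA; apply: ler_pM; rewrite ?hL ?hK //.
  by rewrite mulr_ge0 ?exprn_ge0 // ltW.
by rewrite mulr_ge0 ?exprn_ge0 // ltW.
Qed.

(* Averaging log |B| over the N-th roots of t^N and letting N grow replaces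
   Jensen's formula. *)
Lemma pseudohyp_disk_sup (B : finBlaschke R) z0 (r2 M : R) : nsq z0 < 1 ->
  0 < r2 -> r2 <= 1 ->
  (forall z, nsq z < 1 -> rho2 z0 z < r2 -> nsq (B z) <= M) ->
  r2 ^+ bl_deg B <= M.
Proof.
move=> z01 r0 r1 BM; rewrite leNgt; apply/negP => lt.
set m := bl_deg B in lt.
have M0 : 0 <= M.
  by apply: le_trans (nsq_ge0 (B z0)) (BM _ z01 _); rewrite /rho2 subrr nsq0 mul0r.
have [x /andP[x0 xr] xm] : exists2 x, 0 <= x < r2 & M < x ^+ m.
  (* By Bernoulli's inequality, (r2 (1 - e))^m >= r2^m - m e = M + e. *)
  set e := (r2 ^+ m - M) / (m%:R + 1).
  have m0 : 0 < m%:R + 1 :> R by rewrite ltr_wpDl.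
  have e0 : 0 < e by rewrite divr_gt0 // subr_gt0.
  have rm1 : r2 ^+ m <= 1 by rewrite exprn_ile1 // ltW.
  have eE : e * (m%:R + 1) = r2 ^+ m - M by rewrite divfK // gt_eqF.
  have mn : 0 <= m%:R :> R by [].
  have e1 : e <= 1 by nra.
  exists (r2 * (1 - e)).
    by rewrite mulr_ge0 ?subr_ge0 ?(ltW r0) //= gtr_pMr // ltrBlDr ltrDl.
  have e01 : 0 <= e <= 1 by rewrite ltW.
  have := ler_wpM2l (exprn_ge0 m (ltW r0)) (bernoulli_ge m e01).
  rewrite -exprMn; apply: lt_le_trans.
  have : r2 ^+ m * (m%:R * e) <= m%:R * e by rewrite ler_piMl // mulr_ge0 // ltW.
  rewrite mulrBr mulr1; nra.
pose al := [seq phi z0 a | a <- bl_zeros B].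
have ald : in_disk al.
  by move=> _ /mapP[a aB ->]; apply: nsq_phi_lt1 => //; exact: zeros_in_disk aB.
(* The circle of squared radius y misses the zeros moved by [phi z0], so that [circle_prod_ge]
   applies. *)
have [y /andP[xy yr] yal] := exists_avoid [seq nsq a | a <- al] xr.
have y0 : 0 < y by apply: le_lt_trans xy.
set t := Num.sqrt y; have t2 : t ^+ 2 = y by rewrite sqr_sqrtr // ltW.
have t0 : 0 < t by rewrite sqrtr_gt0.
have t1 : t < 1 by rewrite -ltr_sqr ?nnegrE ?(ltW t0) // expr1n t2 (lt_le_trans yr).
have [|K K0 hK] := circle_prod_ge t0 t1 ald.
  move=> a aal; rewrite t2; apply: contra yal => /eqP <-.
  by apply/mapP; exists a.
have ym : M < y ^+ m.
  by apply: lt_le_trans xm _; rewrite lerXn2r ?nnegrE // ltW.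
have ym0 : 0 < y ^+ m by rewrite exprn_gt0.
(* The product of |B|^2 over the N points, moved back by [phi (- z0)], lies between K y^(m N) and
   M^N; as M < y^m, this fails for large N. *)
have key N : (0 < N)%N -> K <= (M / y ^+ m) ^+ N.
  move=> N0; have [rr [sr nr] pr] := root_circle t0 N0.
  have := hK N N0; rewrite t2 size_map -/(bl_deg B) -/m exprM => h.
  rewrite expr_div_n ler_pdivlMr ?exprn_gt0 //; apply: le_trans h _.
  under eq_bigr do rewrite -pr.
  rewrite exchange_big /= -[in leRHS]sr -prod_const_seq.
  rewrite big_seq [leRHS]big_seq; apply: ler_prod => z /nr zt.
  have z1 : nsq z < 1 by rewrite zt t2 (lt_le_trans yr).
  apply/andP; split; first by apply: prodr_ge0 => a _; exact: rho2_ge0.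
  have zN : nsq (- z0) < 1 by rewrite nsqN.
  have pz1 := nsq_phi_lt1 zN z1.
  apply: le_trans (BM _ pz1 _); last first.
    by rewrite -nsq_phi phiK // zt t2.
  rewrite nsq_bl big_map le_eqVlt; apply/orP; left; apply/eqP.
  rewrite big_seq [RHS]big_seq; apply: eq_bigr => a aB.
  by rewrite -(@rho2_phi z0 a) // ?phiK //; exact: zeros_in_disk aB.
have q1 : `|M / y ^+ m| < 1.
  by rewrite ger0_norm ?divr_ge0 ?(ltW ym0) // ltr_pdivrMr // mul1r.
have /cvgrPdist_lt /(_ K K0) := cvg_expr q1.
move=> [N _ hN]; have := hN N.+1 (leqnSn N) ; rewrite sub0r normrN ger0_norm; last first.
  by rewrite exprn_ge0 // divr_ge0 // ltW.
by rewrite ltNge key.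
Qed.

End Pseudohyperbolic.

(** * The four cases *)

Section Cases.
Variable R : realType.
Implicit Types (Th B : finBlaschke R) (a b c z w : cplx R) (s : seq (cplx R)).

Lemma nsq_continuous z : {for z, continuous (@nsq R)}.
Proof.
have idc : w @[w --> z] --> (z : cplx R) by exact: cvg_id.
exact: (cvg_nsq idc).
Qed.

Lemma rho2_continuous a z : nsq a < 1 -> nsq z <= 1 -> {for z, continuous (rho2 a)}.
Proof.
move=> a1 z1; have FF := nbhs_filter z.
have d := rho2_den_gt0 a1 z1.
have h1 : (w - a) @[w --> z] --> (z - a : cplx R).
  by apply: cvgB; [exact: cvg_id|exact: cvg_cst].
have h2 : (1 - a^* * w : cplx R) @[w --> z] --> (1 - a^* * z : cplx R).
  by apply: cvgB; [exact: cvg_cst|apply: cvgMr; exact: cvg_id].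
by apply: cvgM; [exact: cvg_nsq h1|apply: cvgV; [rewrite gt_eqF|exact: cvg_nsq h2]].
Qed.

(** In the coordinate centered at a1, where a2 becomes d, the midpoint m satisfies d = 2 m / (1 +
    |m|^2), whence m = d / (1 + sqrt(1 - |d|^2)). It is carried back by [phi (- a1)]. *)
Lemma midpoint a1 a2 : nsq a1 < 1 -> nsq a2 < 1 ->
  exists c, exists2 b, nsq c < 1 /\ nsq b < 1 & phi c a1 = - b /\ phi c a2 = b.
Proof.
move=> h1 h2; pose d := phi a1 a2; have d1 : nsq d < 1 by exact: nsq_phi_lt1.
pose e := Num.sqrt (1 - nsq d).
have e0 : 0 < e by rewrite sqrtr_gt0 subr_gt0.
have e2 : e ^+ 2 = 1 - nsq d by rewrite sqr_sqrtr // subr_ge0 ltW.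
have e1 : 0 < 1 + e by rewrite addr_gt0.
pose m : cplx R := d * ((1 + e)^-1)%:C%C.
have mE : nsq m * (1 + e) = 1 - e.
  rewrite nsqM nsq_real exprVn; have -> : nsq d = (1 - e) * (1 + e).
    by rewrite -subr_sqr expr1n e2 subKr.
  by field; rewrite gt_eqF.
have m1 : nsq m < 1 by rewrite -(ltr_pM2r e1) mE mul1r ltrBlDr -addrA ltrDl addr_gt0.
have a1N : nsq (- a1) < 1 by rewrite nsqN.
have dm : d * (1 + m * m^*) = 2 * m.
  rewrite nsq_conj -(rmorph1 (real_complex R)) -rmorphD /=.
  rewrite /m mulrCA -[2](rmorph_nat (real_complex R)) -rmorphM /=; congr (_ * (_)%:C%C).
  have ne : 1 + e != 0 by rewrite gt_eqF.
  by apply: (mulIf ne); rewrite mulrDl mE mul1r mulfVK //; ring.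
have c1 : nsq (phi (- a1) m) < 1 by exact: nsq_phi_lt1.
exists (phi (- a1) m); set c := phi (- a1) m.
have a2E : a2 = phi (- a1) d by rewrite /d phiKV.
have n1 := one_sub_nsq h1.
have nm := one_sub_nsq m1.
have mm2 : 1 + m * m^* != 0.
  rewrite nsq_conj -(rmorph1 (real_complex R)) -rmorphD /= -nsq_gt0 nsq_real.
  by rewrite exprn_gt0 // ltr_pwDl // nsq_ge0.
have [dd _] := phi_den a1N d1; have [dm1 dm2] := phi_den a1N m1.
rewrite rmorphN mulNr opprK in dd; rewrite rmorphN mulNr opprK in dm1.
rewrite mulNr opprK in dm2.
have cE : c = (m + a1) / (1 + a1^* * m) by rewrite /c /phi rmorphN mulNr !opprK.
have cJ : c^* = (m^* + a1^*) / (1 + a1 * m^*).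
  rewrite cE rmorphM fmorphV; congr (_ / _); first exact: rmorphD.
  by rewrite rmorphD rmorph1 rmorphM /= conjCK.
(* The factor next to m is unimodular: the rotation left over from composing automorphisms. *)
have p1 : phi c a1 = - (m * ((1 + a1 * m^*) / (1 + a1^* * m))).
  rewrite /phi cJ cE.
  have -> : a1 - (m + a1) / (1 + a1^* * m) = - m * (1 - a1 * a1^*) / (1 + a1^* * m) by field.
  have -> : 1 - (m^* + a1^*) / (1 + a1 * m^*) * a1 = (1 - a1 * a1^*) / (1 + a1 * m^*) by field.
  by field; rewrite n1 dm1 dm2.
have p2 : phi c a2 = m * ((1 + a1 * m^*) / (1 + a1^* * m)).
  have dE : d = 2 * m / (1 + m * m^*) by rewrite -dm mulfK.
  have e3 : d - m = m * (1 - m * m^*) / (1 + m * m^*) by rewrite dE; field.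
  have e4 : 1 - m^* * d = (1 - m * m^*) / (1 + m * m^*) by rewrite dE; field.
  rewrite /phi cJ cE a2E /phi rmorphN mulNr !opprK.
  have -> : (d + a1) / (1 + a1^* * d) - (m + a1) / (1 + a1^* * m) =
     (d - m) * (1 - a1 * a1^*) / ((1 + a1^* * d) * (1 + a1^* * m)).
    by field; rewrite dd dm1.
  have -> : 1 - (m^* + a1^*) / (1 + a1 * m^*) * ((d + a1) / (1 + a1^* * d)) =
     (1 - m^* * d) * (1 - a1 * a1^*) / ((1 + a1 * m^*) * (1 + a1^* * d)).
    by field; rewrite dd dm2.
  rewrite e3 e4; field.
  by rewrite mm2 nm n1 dd dm1 dm2.
exists (m * ((1 + a1 * m^*) / (1 + a1^* * m))); last by rewrite p1 p2.
by split=> //; rewrite -p2; exact: nsq_phi_lt1.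
Qed.

Lemma rho2_opp_mul b w : rho2 (- b) w * rho2 b w = rho2 (b ^+ 2) (w ^+ 2).
Proof.
rewrite /rho2 mulf_div -!nsqM; congr (nsq _ / nsq _); first by ring.
by rewrite rmorphXn rmorphN /=; ring.
Qed.

Lemma rho2_expand b w :
  nsq (w - b) = nsq w + nsq b - 2 * Re (w * b^*) /\
  nsq (1 - b^* * w) = 1 + nsq w * nsq b - 2 * Re (w * b^*).
Proof.
by case: b w => p q [t u]; rewrite conjE /nsq /=; split; ring.
Qed.

(** Equal distances force Re(w conj(b)) = 0, and then each squared distance is (|w|^2 + |b|^2) / (1
    + |w b|^2) >= 1/2. *)
Lemma rho2_bisector b w : nsq b < 1 -> nsq w < 1 -> rho2 (- b) w = rho2 b w ->
  1 / 2 <= nsq b -> 1 / 4 <= rho2 (- b) w * rho2 b w.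
Proof.
move=> b1 w1 e b2; rewrite e; have bN : nsq (- b) < 1 by rewrite nsqN.
have d1 := rho2_den_gt0 b1 (ltW w1); have d2 := rho2_den_gt0 bN (ltW w1).
suff h : 1 / 2 <= rho2 b w by nra.
move: e; rewrite /rho2 => /eqP; rewrite eqr_div; [|by rewrite gt_eqF|by rewrite gt_eqF].
move=> /eqP.
have [-> E2] := rho2_expand (- b) w; have [E3 E4] := rho2_expand b w.
rewrite ler_pdivlMr //; move: d1 d2; rewrite E2 E3 E4 rmorphN mulrN nsqN.
have -> : Re (- (w * b^*)) = - Re (w * b^*) by case: (w * b^*).
move: b1 w1 b2 (nsq_ge0 b) (nsq_ge0 w); set y := Re _.
move: (nsq b) (nsq w) y => p q y p1 q1 p2 p0 q0 d1 d2 e.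
have /eqP : y * ((1 - p) * (1 - q)) = 0 by nra.
rewrite mulf_eq0 mulf_eq0 !subr_eq0 !(gt_eqF p1, gt_eqF q1) !orbF => /eqP y0.
have : 0 <= q * (p - 1 / 2) by rewrite mulr_ge0 // subr_ge0.
have : 0 <= q * (1 - p) by rewrite mulr_ge0 // subr_ge0 ltW.
rewrite y0; nra.
Qed.

Lemma case_far_zeros Th B a1 a2 b c : (2 < bl_deg Th)%N ->
  bl_zeros B = [:: a1; a2] -> nsq c < 1 -> nsq b < 1 ->
  phi c a1 = - b -> phi c a2 = b -> 1 / 2 <= nsq b ->
  exists2 z, W_shift Th z & 1 / 4 <= nsq (B z).
Proof.
move=> n2 BE c1 b1 p1 p2 b2.
have a11 : nsq a1 < 1 by apply: (@zeros_in_disk _ B); rewrite BE inE eqxx.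
have a21 : nsq a2 < 1 by apply: (@zeros_in_disk _ B); rewrite BE !inE eqxx orbT.
have BR z : nsq (B z) = rho2 a1 z * rho2 a2 z by rewrite nsq_bl BE big_cons big_seq1.
apply: contrapT => no.
have lt z : W_shift Th z -> nsq (B z) < 1 / 4.
  by move=> Wz; rewrite ltNge; apply/negP => h; apply: no; exists z.
rewrite W_shiftE in no lt; have sd := @zeros_in_disk _ Th.
have half a z : 1 / 2 * nsq (1 - a^* * z) <= nsq (z - a) -> nsq a < 1 ->
    nsq z <= 1 -> 1 / 2 <= rho2 a z.
  by move=> h a1' z1; rewrite ler_pdivlMr // rho2_den_gt0.
have [z1 W1 /half/(_ a11 (Wseq_disk W1)) h1] := W_far_half sd n2 a11.
have [z2 W2 /half/(_ a21 (Wseq_disk W2)) h2] := W_far_half sd n2 a21.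
have l1 := lt _ W1; have l2 := lt _ W2; rewrite BR in l1; rewrite BR in l2.
pose psi z := rho2 a1 z - rho2 a2 z.
have cpsi z : Wseq (bl_zeros Th) z -> {for z, continuous psi}.
  move=> /Wseq_disk zd; have FF := nbhs_filter z.
  by apply: cvgB; exact: rho2_continuous.
(* At [z2] the squared distance to [a2] is at least 1/2 while the product is below 1/4, so [a1] is
   the nearer zero; symmetrically at [z1]. *)
have psi2 : psi z2 <= 0 by rewrite /psi subr_le0; have := rho2_ge0 a1 z2; nra.
have psi1 : 0 <= psi z1 by rewrite /psi subr_ge0; have := rho2_ge0 a2 z1; nra.
have [z Wz e] := Wseq_ivt W2 W1 cpsi psi2 psi1.
have zl := lt _ Wz; have zd : nsq z < 1.
  rewrite ltNge; apply/negP => zg; have := Wseq_disk Wz => zle.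
  have dz a : a \in bl_zeros B -> 1 - a^* * z != 0.
    by move=> aB; apply: blaschke_den_neq0 => //; exact: zeros_in_disk aB.
  have := le_lt_trans (nsq_bl_ge1 dz zg) zl; lra.
move: zl; rewrite BR -(rho2_phi c1 a11 zd) -(rho2_phi c1 a21 zd) p1 p2.
rewrite ltNge => /negP; apply; apply: rho2_bisector => //; first exact: nsq_phi_lt1.
rewrite -p1 -p2 !rho2_phi //; move/eqP: e.
by rewrite /psi subr_eq0 => /eqP.
Qed.

Lemma case_deg6 Th B a1 a2 b c : (5 < bl_deg Th)%N ->
  bl_zeros B = [:: a1; a2] -> nsq c < 1 -> nsq b < 1 ->
  phi c a1 = - b -> phi c a2 = b -> nsq b < 1 / 2 ->
  exists2 z, W_shift Th z & 1 / 4 <= nsq (B z).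
Proof.
move=> n5 BE c1 b1 p1 p2 b2.
have a11 : nsq a1 < 1 by apply: (@zeros_in_disk _ B); rewrite BE inE eqxx.
have a21 : nsq a2 < 1 by apply: (@zeros_in_disk _ B); rewrite BE !inE eqxx orbT.
have BR z : nsq (B z) = rho2 a1 z * rho2 a2 z by rewrite nsq_bl BE big_cons big_seq1.
have [z Wz h] := W_far_four_fifths (@zeros_in_disk _ Th) n5 c1.
exists z; first by rewrite W_shiftE.
have [zd|zg] := ltP (nsq z) 1; last first.
  have dz a : a \in bl_zeros B -> 1 - a^* * z != 0.
    by move=> aB; apply: blaschke_den_neq0; [exact: zeros_in_disk aB|exact: Wseq_disk Wz].
  have := nsq_bl_ge1 dz zg; lra.
have w1 := nsq_phi_lt1 c1 zd.
have w45 : 4 / 5 <= nsq (phi c z) by rewrite nsq_phi ler_pdivlMr // rho2_den_gt0 // ltW.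
rewrite BR -(rho2_phi c1 a11 zd) -(rho2_phi c1 a21 zd) p1 p2 rho2_opp_mul.
set w := phi c z in w1 w45 *.
have b21 : nsq (b ^+ 2) < 1 by rewrite nsqX exprn_ilt1 ?nsq_ge0.
have w21 : nsq (w ^+ 2) <= 1 by rewrite nsqX exprn_ile1 ?nsq_ge0 // ltW.
(* The moduli are now p = |b|^2 < 1/2 and q = |w|^2 >= 4/5, and (q - p) / (1 - q p) equals 1/2 at
   the extreme p = 1/2, q = 4/5. *)
apply: le_trans (rho2_ge_moduli b21 w21 (nsq_ge0 b) _ (nsq_ge0 w) _); rewrite ?nsqX //.
move: b1 b2 w1 w45 (nsq_ge0 b); move: (nsq b) (nsq w) => {p1 p2} p q p1 p2 q1 q2 p0.
have d : 0 < 1 - q * p by nra.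
rewrite expr_div_n ler_pdivlMr ?exprn_gt0 //.
have h1 : 0 <= 2 * (q - p) - (1 - q * p) by nra.
have h2 : 0 <= 2 * (q - p) + (1 - q * p) by nra.
have := mulr_ge0 h1 h2; nra.
Qed.

(** The pseudohyperbolic disk of radius 1/2 about b is a Euclidean disk and contains 0 since |b| <
    1/2; hence it is star-shaped about 0. *)
Lemma rho2_star b w (t : R) : nsq b < 1 / 4 -> nsq w < 1 -> 0 <= t <= 1 ->
  rho2 b w < 1 / 4 -> rho2 b (t%:C%C * w) < 1 / 4.
Proof.
move=> b4 w1 /andP[t0 t1]; have b1 : nsq b < 1 by lra.
have tw : nsq (t%:C%C * w) <= 1.
  rewrite nsqM nsq_real -[1]mulr1 ler_pM ?sqr_ge0 ?nsq_ge0 ?(ltW w1) //.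
  by rewrite exprn_ile1.
have d1 := rho2_den_gt0 b1 (ltW w1); have d2 := rho2_den_gt0 b1 tw.
rewrite /rho2 !ltr_pdivrMr //.
have [-> ->] := rho2_expand b w; have [-> ->] := rho2_expand b (t%:C%C * w).
rewrite nsqM nsq_real.
have -> : Re (t%:C%C * w * b^*) = t * Re (w * b^*).
  by rewrite -mulrA; case: (w * b^*) => x y /=; rewrite mul0r subr0.
move: (nsq_ge0 b) (nsq_ge0 w); move: b4 w1 {b1 tw d1 d2}; set y := Re _.
move: (nsq b) (nsq w) y => p q y p4 q1 p0 q0 H.
(* The quantity to be shown positive is the sum of this term, [g1] and [g0]; the last is positive
   unless t = 1. *)
have K : 0 <= t * (1 - t) * (q * (1 - p / 4)).
  by rewrite !mulr_ge0 // subr_ge0 //; lra.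
have g1 : 0 <= t * (1 / 4 * (1 + q * p - 2 * y) - (q + p - 2 * y)).
  by rewrite mulr_ge0 // subr_ge0 ltW.
have g0 : 0 <= (1 - t) * (1 / 4 - p) by rewrite mulr_ge0 // subr_ge0 // ltW.
have [t'|t'] := ltP t 1.
  have : 0 < (1 - t) * (1 / 4 - p) by rewrite mulr_gt0 // subr_gt0.
  nra.
have -> : t = 1 by apply/eqP; rewrite eq_le t1.
by move: H; rewrite expr1n !mul1r.
Qed.

Lemma bl_sublevelE B z : bl_sublevel B 2^-1 z <-> nsq z < 1 /\ nsq (B z) < 1 / 4.
Proof.
have half : (2^-1 : cplx R) = (2^-1 : R)%:C%C by rewrite fmorphV rmorph_nat.
have q : (2^-1 : R) ^+ 2 = 1 / 4 by rewrite exprVn -natrX mul1r.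
rewrite /bl_sublevel /= half; split=> [[d]|[z1 Bz]].
  rewrite ltr_nsqr ?invr_ge0 // q => Bz; split=> //.
  rewrite ltNge; apply/negP => /(nsq_bl_ge1 d) h; have := le_lt_trans h Bz; lra.
split; last by rewrite ltr_nsqr ?invr_ge0 // q.
by move=> a aB; apply: blaschke_den_neq0; [exact: zeros_in_disk aB|exact: ltW].
Qed.

(** In the coordinate w centered at c, |B| is the distance from w^2 to b^2. Scaling w by t scales
    w^2 by t^2, so [rho2_star] keeps the segment from c to any point inside the set, and all these
    segments share c. *)
Lemma sublevel_connected B a1 a2 b c :
  bl_zeros B = [:: a1; a2] -> nsq c < 1 -> nsq b < 1 ->
  phi c a1 = - b -> phi c a2 = b -> nsq b < 1 / 2 ->
  connected (bl_sublevel B 2^-1).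
Proof.
move=> BE c1 b1 p1 p2 b2.
have a11 : nsq a1 < 1 by apply: (@zeros_in_disk _ B); rewrite BE inE eqxx.
have a21 : nsq a2 < 1 by apply: (@zeros_in_disk _ B); rewrite BE !inE eqxx orbT.
have BR z : nsq z < 1 -> nsq (B z) = rho2 (b ^+ 2) (phi c z ^+ 2).
  move=> z1; rewrite nsq_bl BE big_cons big_seq1 -(rho2_phi c1 a11 z1).
  by rewrite -(rho2_phi c1 a21 z1) p1 p2 rho2_opp_mul.
have cN : nsq (- c) < 1 by rewrite nsqN.
have b4 : nsq (b ^+ 2) < 1 / 4 by rewrite nsqX; have := nsq_ge0 b; nra.
pose gam z (t : R) : cplx R := phi (- c) (t%:C%C * phi c z).
pose seg z := gam z @` `[0 : R, 1]%classic.
have tin z (t : R) : nsq z < 1 -> 0 <= t <= 1 -> nsq (t%:C%C * phi c z) < 1.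
  move=> z1 /andP[t0 t1]; rewrite nsqM nsq_real.
  apply: le_lt_trans (nsq_phi_lt1 c1 z1); rewrite ler_piMl ?nsq_ge0 //.
  by rewrite exprn_ile1.
have E : bl_sublevel B 2^-1 = \bigcup_(z in bl_sublevel B 2^-1) seg z.
  apply/seteqP; split=> [z Bz|z' [z Bz [t]]].
    have [z1 _] := (bl_sublevelE B z).1 Bz.
    exists z => //; exists 1; first by rewrite /= in_itv /= ler01 lexx.
    by rewrite /gam mul1r phiKV.
  rewrite /= in_itv /= => t01 <-; have [z1 Bz1] := (bl_sublevelE B z).1 Bz.
  have tz := tin z t z1 t01.
  have g1 : nsq (gam z t) < 1 by exact: nsq_phi_lt1.
  apply/(bl_sublevelE B _); split=> //; rewrite BR // /gam phiK // exprMn -rmorphXn /=.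
  have /andP[t0 t1] := t01; apply: rho2_star => //.
  - by rewrite nsqX exprn_ilt1 ?nsq_ge0 // nsq_phi_lt1.
  - by rewrite exprn_ge0 // exprn_ile1.
  - by rewrite -BR.
rewrite E; apply: bigcup_connected.
  exists c => z _; exists 0; first by rewrite /= in_itv /= lexx ler01.
  by rewrite /gam mul0r /phi sub0r opprK mulr0 subr0 divr1.
move=> z Bz; have [z1 _] := (bl_sublevelE B z).1 Bz.
apply: connected_continuous_connected; first exact: segment_connected.
apply: continuous_in_subspaceT => t; rewrite inE /= in_itv /= => t01.
have FF := nbhs_filter t.
have cC : (x%:C%C * phi c z : cplx R) @[x --> t] --> (t%:C%C * phi c z : cplx R).
  apply: cvgMl; apply: cvg_complex => /=; [exact: cvg_id|exact: cvg_cst].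
apply: cvgM; first by apply: cvgB; [exact: cC|exact: cvg_cst].
apply: cvgV; first by apply: blaschke_den_neq0 => //; apply/ltW/tin.
by apply: cvgB; [exact: cvg_cst|apply: cvgMr; exact: cC].
Qed.

Lemma connected_components_card (T : topologicalType) (A : set T) :
  connected A -> ~ (components A #= `I_2)%card.
Proof.
move=> cA h.
have sub : components A `<=` [set A].
  move=> _ [x Ax <-]; apply/seteqP; split; first exact: connected_component_sub.
  exact: connected_component_max.
have := subset_card_le sub; rewrite (card_le_eql h) (card_le_eqr card_set1).
by rewrite card_le_II.
Qed.

(** For two factors the difference is r (1 + r) (1 - x P) (1 - x) (1 - P) over a positive
    denominator. With x the moduli of zeros, this is a Schwarz-Pick lower bound for a Blaschke
    product on |z| = r. *)
Lemma phi_prod (r : R) (l : seq R) : 0 <= r < 1 -> (forall x, x \in l -> 0 <= x <= 1) ->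
  r <= \prod_(x <- l) x ->
  (\prod_(x <- l) x - r) / (1 - r * \prod_(x <- l) x) <=
  \prod_(x <- l) ((x - r) / (1 - r * x)).
Proof.
move=> /andP[r0 r1]; elim: l => [_ _|x l IH h].
  by rewrite !big_nil mulr1 divff // gt_eqF // subr_gt0.
rewrite !big_cons; set P := \prod_(y <- l) y => rP.
have /andP[x0 x1] : 0 <= x <= 1 by apply: h; rewrite mem_head.
have hl y : y \in l -> 0 <= y <= 1 by move=> yl; apply: h; rewrite inE yl orbT.
have /andP[P0 P1] : 0 <= P <= 1.
  rewrite /P big_seq; apply/andP; split.
    by apply: prodr_ge0 => y /hl/andP[].
  by apply: prodr_ile1 => y /hl.
have rP' : r <= P by apply: le_trans rP _; rewrite ler_piMl.
have rx : r <= x by apply: le_trans rP _; rewrite ler_piMr.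
have d1 : 0 < 1 - r * x by rewrite subr_gt0; nra.
have d2 : 0 < 1 - r * P by rewrite subr_gt0; nra.
have d3 : 0 < 1 - r * (x * P) by rewrite subr_gt0; have := mulr_ile1 x0 P0 x1 P1; nra.
have fx : 0 <= (x - r) / (1 - r * x) by apply: divr_ge0; [rewrite subr_ge0|exact: ltW].
apply: le_trans (ler_wpM2l fx (IH hl rP')).
rewrite -subr_ge0.
have -> : (x - r) / (1 - r * x) * ((P - r) / (1 - r * P)) - (x * P - r) / (1 - r * (x * P)) =
  r * (1 + r) * (1 - x * P) * ((1 - x) * (1 - P)) /
  ((1 - r * x) * (1 - r * P) * (1 - r * (x * P))).
  by field; rewrite !gt_eqF.
apply: divr_ge0; last by rewrite !mulr_ge0 // ltW.
by rewrite !mulr_ge0 ?subr_ge0 // ?addr_ge0 // mulr_ile1.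
Qed.

(** Write B = z C by removing one zero at the origin; the derivative at 0 is C(0). *)
Lemma derive1_bl0 B : B 0 = 0 -> exists2 l : seq (cplx R),
  perm_eq (bl_zeros B) (0 :: l) & nsq (derive1 B 0) = \prod_(a <- l) nsq a.
Proof.
move=> B0.
have z0 : 0 \in bl_zeros B.
  have := congr1 (@nsq R) B0; rewrite nsq_bl nsq0 => /eqP.
  rewrite prodf_seq_eq0 => /hasP[a aB]; rewrite /= /rho2 mulr0 subr0 nsq1 divr1.
  by rewrite sub0r nsqN nsq_eq0 => /eqP <-.
pose l := rem 0 (bl_zeros B); have pl : perm_eq (bl_zeros B) (0 :: l) by exact: perm_to_rem.
exists l => //.
have ld : in_disk l by move=> a al; apply: (@zeros_in_disk _ B); rewrite (perm_mem pl) inE al orbT.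
pose C w : cplx R := bl_const B * \prod_(a <- l) ((w - a) / (1 - a^* * w)).
have BC w : B w = w * C w.
  by rewrite /bl_fun (perm_big _ pl) big_cons subr0 conjC0 mul0r subr0 divr1 mulrCA.
have FF := nbhs_filter (0 : cplx R).
have CC : C w @[w --> (0 : cplx R)] --> C 0.
  apply: cvgMr; apply: (@cvg_prod_seq R _ _ l _ FF
    (fun a w => (w - a) / (1 - a^* * w)) (fun a => (0 - a) / (1 - a^* * 0))).
  move=> a /ld a1; apply: cvgM; first by apply: cvgB; [exact: cvg_id|exact: cvg_cst].
  apply: cvgV; first by apply: blaschke_den_neq0 => //; rewrite nsq0.
  by apply: cvgB; [exact: cvg_cst|apply: cvgMr; exact: cvg_id].
have -> : derive1 B 0 = C 0.
  rewrite /derive1; apply: (cvg_lim (@norm_hausdorff _ _)).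
  have CC' : C w @[w --> (0 : cplx R)^'] --> C 0.
    by apply: cvg_trans CC; apply: cvg_app; exact: cvg_within.
  apply: cvg_trans CC'; apply: near_eq_cvg; near=> h.
  have h0 : h != 0 by near: h; exact: nbhs_dnbhs_neq.
  by rewrite addr0 !BC mul0r subr0 /GRing.scale /= mulrA mulVf // mul1r.
rewrite /C nsqM (norm1_nsq (bl_constP B)) mul1r nsq_prod.
by apply: eq_bigr => a _; rewrite mulr0 subr0 divr1 sub0r nsqN.
Unshelve. all: by end_near. Qed.

Lemma case_derive Th B : B 0 = 0 -> 8 / 9 <= nsq (derive1 B 0) ->
  (2 < bl_deg Th)%N -> W_shift Th 0 ->
  exists2 z, W_shift Th z & 1 / 4 <= nsq (B z).
Proof.
move=> B0; have [l pl ->] := derive1_bl0 B0 => D n2; rewrite W_shiftE => W0.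
have n01 : nsq (0 : cplx R) < 1 by rewrite nsq0.
have [z1 W1] := W_far_half (@zeros_in_disk _ Th) n2 n01.
rewrite conjC0 mul0r !subr0 nsq1 mulr1 => h1.
have lo : nsq (0 : cplx R) <= 1 / 2 by rewrite nsq0; lra.
(* The numerical range contains 0 and a point with |z|^2 >= 1/2, so it meets the circle |z|^2 =
   1/2. *)
have [z Wz zh] := Wseq_ivt W0 W1 (fun w _ => @nsq_continuous w) lo h1.
exists z => //; have ld : in_disk l.
  by move=> a al; apply: (@zeros_in_disk _ B); rewrite (perm_mem pl) inE al orbT.
rewrite nsq_bl (perm_big _ pl) big_cons rho2_0 zh.
set r := Num.sqrt (1 / 2 : R); have r2 : r ^+ 2 = 1 / 2 by rewrite sqr_sqrtr //; lra.
have r0 : 0 <= r by exact: sqrtr_ge0.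
have r1 : r < 1 by rewrite -ltr_sqr ?nnegrE // expr1n r2; lra.
have zle : nsq z <= 1 by rewrite zh; lra.
pose m := [seq Num.sqrt (nsq a) | a <- l].
have mI x : x \in m -> 0 <= x <= 1.
  move=> /mapP[a /ld a1 ->]; rewrite sqrtr_ge0 /=.
  by rewrite -[1](sqrtr1 R) ler_sqrt // ltW.
set P := \prod_(x <- m) x.
have P2 : P ^+ 2 = \prod_(a <- l) nsq a.
  rewrite /P big_map -prodrXl; apply: eq_bigr => a _.
  by rewrite sqr_sqrtr // nsq_ge0.
have P0 : 0 <= P by rewrite /P big_seq; apply: prodr_ge0 => x /mI/andP[].
have P1 : P <= 1 by rewrite /P big_seq; apply: prodr_ile1 => x /mI.
have P43 : 4 / 3 * r <= P.
  have r43 : 0 <= 4 / 3 * r by apply: mulr_ge0 => //; lra.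
  by rewrite -ler_sqr ?nnegrE // exprMn r2 P2; apply: le_trans D; lra.
have rP : r <= P by lra.
have d : 0 < 1 - r * P by rewrite subr_gt0; nra.
have h := phi_prod (introT andP (conj r0 r1)) mI rP.
(* From P >= 4 r / 3 and r^2 = 1/2 follow P - r >= r / 3 and 1 - r P <= 1/3. So the factors other
   than z have product of modulus at least r, and |B| >= r^2 = 1/2. *)
have rh : r <= (P - r) / (1 - r * P) by rewrite ler_pdivlMr //; nra.
have hh := le_trans rh h.
have : r ^+ 2 <= \prod_(a <- l) rho2 a z.
  apply: (@le_trans _ _ ((\prod_(x <- m) ((x - r) / (1 - r * x))) ^+ 2)).
    by rewrite ler_sqr ?nnegrE // (le_trans r0).
  rewrite big_map -prodrXl big_seq [leRHS]big_seq; apply: ler_prod => a al.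
  rewrite sqr_ge0 /=; apply: (rho2_ge_moduli (ld a al) zle (sqrtr_ge0 _) _ r0 _).
    by rewrite sqr_sqrtr // nsq_ge0.
  by rewrite r2.
rewrite r2 => hQ; have := ler_wpM2l (_ : 0 <= 1 / 2) hQ; move=> /(_ ltac:(lra)).
by apply: le_trans; lra.
Qed.

End Cases.

Theorem theorem1p4 (R : realType) (Theta B : finBlaschke R) :
  (bl_deg B < bl_deg Theta)%N ->
  [\/ exists2 z0 : cplx R, unit_disk z0 &
        pseudohyp_disk z0 ((2^-1 : R) `^ ((bl_deg Theta).-1%:R)^-1)
          `<=` W_shift Theta,
      bl_deg B = 2%N /\ (6 <= bl_deg Theta)%N,
      [/\ B 0 = 0, ((2 * Num.sqrt 2 / 3 : R)%:C)%C <= `|derive1 B 0|,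
          (9 <= bl_deg Theta)%N & W_shift Theta 0] |
      bl_deg B = 2%N /\ (components (bl_sublevel B 2^-1) #= `I_2)%card] ->
  exists2 M : cplx R, is_max [set `|B z| | z in W_shift Theta] M & 2^-1 <= M.
Proof.
move=> degs cases.
suff [z Wz Bz] : exists2 z, W_shift Theta z & 1 / 4 <= nsq (B z).
  by apply: (is_max_of_ge_half Wz); rewrite -[_^-1]mul1r.
have two : bl_deg B = 2%N -> exists a1 a2, bl_zeros B = [:: a1; a2].
  rewrite /bl_deg; case: (bl_zeros B) => [|a1 [|a2 [|]]] // _.
  by exists a1, a2.
have mid a1 a2 : bl_zeros B = [:: a1; a2] ->
    exists c, exists2 b, nsq c < 1 /\ nsq b < 1 & phi c a1 = - b /\ phi c a2 = b.
  move=> BE; apply: midpoint; apply: (@zeros_in_disk _ B);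
  by rewrite BE !inE eqxx ?orbT.
case: cases => [[z0 z01 sub]|[d2 n6]|[B0 D n9 W0]|[d2 comp]].
- rewrite unit_diskE in z01.
  set r := _ `^ _ in sub; have r0 : 0 < r by rewrite powR_gt0 // invr_gt0.
  have r1 : r <= 1.
    rewrite -[X in _ <= X](powRr0 (2^-1 : R)) /r; apply: ger_powR; last by rewrite invr_ge0.
    by apply/andP; split; lra.
  have rn : 1 / 2 <= r ^+ bl_deg B.
    (* If [bl_deg Theta] is 1, the exponent is the inverse of 0, which is 0; then B has degree 0 and
       its power of r is 1. *)
    have [e|n0] := eqVneq (bl_deg Theta).-1 0%N.
      have -> : bl_deg B = 0%N by move: degs e; case: (bl_deg Theta) => [|[|]] //; case: bl_deg.
      by rewrite expr0; lra.
    have rE : r ^+ (bl_deg Theta).-1 = 1 / 2.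
      rewrite -powR_mulrn ?(ltW r0) // /r -powRrM mulVf ?powRr1 ?mul1r ?invr_ge0 //.
      by rewrite pnatr_eq0.
    rewrite -rE; apply: ler_wiXn2l => //; first exact: ltW.
    by move: degs; case: (bl_deg Theta).
  have diskW z : nsq z < 1 -> rho2 z0 z < r ^+ 2 -> W_shift Theta z.
    move=> z1 zr; apply: sub; split; first by rewrite unit_diskE.
    by rewrite ltr_nsqr ?(ltW r0) // nsqM nsqV.
  have Wz0 : W_shift Theta z0.
    by apply: diskW => //; rewrite /rho2 subrr nsq0 mul0r exprn_gt0.
  (* The maximum of |B|^2 over the numerical range bounds it on the disk, so by [pseudohyp_disk_sup]
     it is at least the square of r^(deg B) >= 1/2. *)
  have [|z Wz zmax] := @bl_max_exists R Theta B; first by exists z0.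
  exists z => //.
  have := @pseudohyp_disk_sup R B z0 (r ^+ 2) (nsq (B z)) z01 (exprn_gt0 2 r0) _ _.
  move=> h; apply: le_trans (h _ _).
  + by rewrite -exprM mulnC exprM; move: rn; set q := _ ^+ bl_deg B; nra.
  + by rewrite exprn_ile1 // ltW.
  + by move=> w w1 wr; apply: zmax; exact: diskW.
- have [a1 [a2 BE]] := two d2; have [c [b [c1 b1] [p1 p2]]] := mid _ _ BE.
  have [b2|b2] := ltP (nsq b) (1 / 2).
    exact: (case_deg6 n6 BE c1 b1 p1 p2 b2).
  by apply: (case_far_zeros _ BE c1 b1 p1 p2 b2); apply: leq_trans n6.
- apply: case_derive => //; last by apply: leq_trans n9.
  move: D; rewrite ger_nsqr; last by rewrite divr_ge0 // mulr_ge0 // sqrtr_ge0.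
  apply: le_trans; rewrite expr_div_n exprMn sqr_sqrtr //; lra.
- have [a1 [a2 BE]] := two d2; have [c [b [c1 b1] [p1 p2]]] := mid _ _ BE.
  have [b2|b2] := ltP (nsq b) (1 / 2).
    by case: (connected_components_card (sublevel_connected BE c1 b1 p1 p2 b2)).
  by apply: (case_far_zeros _ BE c1 b1 p1 p2 b2); rewrite -d2.
Qed.
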